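(* Let $\nu$ be a Thorin measure on $\mathbb{R}_+^d$ with $\int_{\mathbb{R}_+^d}\|s\|\,\nu(\mathrm{d}s)<\infty$, and let $\mathbb{P}_\nu$ be the law $\mathcal{G}_d(\nu)$, with integral Stein operator $$(\mathcal{T}_\nu f)(x)=\langle x,f(x)\rangle-\int_{\mathbb{R}_+^d}\mathbb{E}\bigl[\langle s,f(x+sE)\rangle\bigr]\,\nu(\mathrm{d}s),\qquad E\sim\mathrm{Exp}(1).$$ Let $K(x,y)=k(x,y)I_d$ with $k$ a bounded continuous scalar reproducing kernel on $\mathbb{R}^d$, and suppose that $\mathrm{KSD}_{\mathcal{T}}(\cdot\,\|\,\mathbb{P}_\nu)$ is a statistical divergence, i.e. for every probability measure $\mathbb{Q}$ on $\mathbb{R}^d$ such that $\mathcal{T}_\nu f$ is $\mathbb{Q}$-integrable for every $f\in\mathcal{H}_K$, $\mathrm{KSD}_{\mathcal{T}}(\mathbb{Q}\,\|\,\mathbb{P}_\nu)=0$ if and only if $\mathbb{Q}=\mathbb{P}_\nu$. Let $(\mathbb{Q}_N)_{N\ge 1}$, where $\mathbb{Q}_N=\mathbb{P}_{\nu_N}$ is the law $\mathcal{G}_d(\nu_N)$, be a sequence whose Thorin measures $\nu_N$ satisfy $$\sup_{N\ge 1}\int_{\mathbb{R}_+^d}\bigl(\|s\|+\|s\|^2\bigr)\,\nu_N(\mathrm{d}s)<\infty.$$ Then $$\mathrm{KSD}_{\mathcal{T}}(\mathbb{Q}_N\,\|\,\mathbb{P}_\nu)\xrightarrow[N\to\infty]{}0\quad\Longrightarrow\quad\mathbb{Q}_N\Rightarrow\mathbb{P}_\nu\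 \text{ weakly as } N\to\infty.$$
   Context: $d\ge 1$ is a fixed integer, $\mathbb{R}_+=[0,\infty)$, $\langle\cdot,\cdot\rangle$ and $\|\cdot\|$ are Euclidean, $I_d$ the identity matrix. A Thorin measure on $\mathbb{R}_+^d$ is a positive Radon measure $\nu$ on $\mathbb{R}_+^d$ with $\int_{\{\|s\|\le 1\}}|\log\|s\||\,\nu(\mathrm{d}s)<\infty$ and $\int_{\{\|s\|>1\}}\|s\|^{-1}\,\nu(\mathrm{d}s)<\infty$ (with $|\log 0|=+\infty$). $\mathcal{G}_d(\nu)$ is the law on $\mathbb{R}_+^d$ whose characteristic function $\varphi$ satisfies $\log\varphi(t)=-\int_{\mathbb{R}_+^d}\log(1-\mathrm{i}\langle s,t\rangle)\,\nu(\mathrm{d}s)$, $t\in\mathbb{R}^d$ (principal branch under the integral). A scalar reproducing kernel is a symmetric positive semi-definite function $k:\mathbb{R}^d\times\mathbb{R}^d\to\mathbb{R}$. $\mathcal{H}_K$ is the vector-valued RKHS of $K$: the unique Hilbert space of functions $f:\mathbb{R}^d\to\mathbb{R}^d$ containing all $K(\cdot,x)v$ ($x,v\in\mathbb{R}^d$) and satisfying $\langle f(x),v\rangle=\langle f,K(\cdot,x)v\rangle_{\mathcal{H}_K}$. The Kernel Stein Discrepancy is $$\mathrm{KSD}_{\mathcal{T}}(\mathbb{Q}\,\|\,\mathbb{P}_\nu)=\sup_{f\in\mathcal{H}_K,\ \|f\|_{\mathcal{H}_K}\le 1}\bigl|\mathbb{E}_{Y\sim\mathbb{Q}}[(\mathcal{T}_\nu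 f)(Y)]\bigr|.$$ *)

(* Defs.v *)
From HB Require Import structures.
From mathcomp Require Import all_boot all_order all_algebra.
From mathcomp Require Import all_classical all_reals all_analysis.
From mathcomp.real_closed Require Import complex.

Set Implicit Arguments.
Unset Strict Implicit.
Unset Printing Implicit Defensive.

Import Order.TTheory GRing.Theory Num.Theory.
Import numFieldNormedType.Exports.

Local Open Scope classical_set_scope.
Local Open Scope ring_scope.

(* The Borel sigma-algebra on matrices; R^d is 'rV[R]_d.  The norm of the
   library on 'rV[R]_d is the sup norm: it is used here only through the
   topology, the Euclidean norm being [enorm]. *)
HB.instance Definition _ (R : realType) (m n : nat) :=
  @isMeasurable.Build (sigma_display (@open 'M[R]_(m, n))) 'M[R]_(m, n)
    <<s open >> (@sigma_algebra0 _ setT open) (@sigma_algebraC _ open)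
    (@sigma_algebra_bigcup _ setT open).

Section Euclidean.
Context {R : realType} {d : nat}.
Implicit Types u v : 'rV[R]_d.

Definition dotp u v : R := \sum_(i < d) u 0 i * v 0 i.

Definition enorm u : R := Num.sqrt (dotp u u).

Definition orthant : set 'rV[R]_d := [set u | forall i, 0 <= u 0 i].

End Euclidean.

Section Complex.
Context {R : realType}.
Implicit Type z : R[i].

Definition expC z : R[i] :=
  ((expR (complex.Re z) * cos (complex.Im z)) +i* (expR (complex.Re z) * sin (complex.Im z)))%C.

(* Argument in ]-pi, pi]; only meaningful for z != 0. *)
Definition argC z : R :=
  let a := acos (complex.Re z / Normc.normc z) in if 0 <= complex.Im z then a else - a.

(* Principal branch of the logarithm. *)
Definition logC z : R[i] := (ln (Normc.normc z) +i* argC z)%C.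

Definition integralC {disp} {T : measurableType disp}
    (mu : {measure set T -> \bar R}) (D : set T) (f : T -> R[i]) : R[i] :=
  ((\int[mu]_(x in D) complex.Re (f x)) +i* (\int[mu]_(x in D) complex.Im (f x)))%C.

End Complex.

Section Thorin.
Context {R : realType} {d : nat}.
Implicit Types (nu : {measure set 'rV[R]_d -> \bar R})
  (P : probability 'rV[R]_d R).

Definition radon nu : Prop :=
  (forall C, compact C -> (nu C < +oo)%E) /\
  (forall A, measurable A ->
    nu A = ereal_sup [set nu C | C in [set C | compact C /\ C `<=` A]]).

(* Measures on the orthant are encoded as measures on the whole space that
   vanish outside of it.  Note that [lne 0 = -oo]. *)
Definition thorin nu : Prop :=
  [/\ nu (~` orthant) = 0%E,
      radon nu,
      (\int[nu]_(s in orthant `&` [set s | enorm s <= 1]%R)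
         `|lne (enorm s)%:E| < +oo)%E &
      (\int[nu]_(s in orthant `&` [set s | 1 < enorm s]%R)
         ((enorm s)^-1)%:E < +oo)%E].

Definition char_fun P (t : 'rV[R]_d) : R[i] :=
  integralC P setT (fun x => expC ('i%C * ((dotp t x)%:C)%C)).

Definition thorin_exponent nu (t : 'rV[R]_d) : R[i] :=
  - integralC nu orthant (fun s => logC (1 - 'i%C * ((dotp s t)%:C)%C)).

(* P is the law G_d(nu).  The logarithm of a non-vanishing characteristic
   function is its continuous determination vanishing at 0 (and not the
   principal value), so that [log phi = psi], with psi continuous and
   psi 0 = 0, means [phi = exp psi]. *)
Definition thorin_law nu P : Prop :=
  P (~` orthant) = 0%E /\
  forall t, char_fun P t = expC (thorin_exponent nu t).

End Thorin.

Section Kernels.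
Context {R : realType} {d : nat}.
Local Notation V := 'rV[R]_d.

Definition scalar_kernel (k : V -> V -> R) : Prop :=
  (forall x y, k x y = k y x) /\
  (forall (n : nat) (x : 'I_n -> V) (c : 'I_n -> R),
     0 <= \sum_(i < n) \sum_(j < n) c i * c j * k (x i) (x j)).

(* The function K(., x) v, written with row vectors. *)
Definition ksection (K : V -> V -> 'M[R]_d) (x v : V) : V -> V :=
  fun y => v *m (K y x)^T.

(* The vector-valued RKHS of K: a complete normed space whose norm comes from
   an inner product, identified by the injective linear map [rkhs_fun] with a
   space of functions.  It is unique up to isomorphism. *)
Record vvRKHS (K : V -> V -> 'M[R]_d) := VVRKHS {
  rkhs_car :> completeNormedModType R ;
  rkhs_dot : rkhs_car -> rkhs_car -> R ;
  rkhs_fun : rkhs_car -> V -> V ;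
  rkhs_dotC : forall f g, rkhs_dot f g = rkhs_dot g f ;
  rkhs_dot_linear : forall a f g h,
    rkhs_dot (a *: f + g) h = a * rkhs_dot f h + rkhs_dot g h ;
  rkhs_norm : forall f, rkhs_dot f f = `|f| ^+ 2 ;
  rkhs_fun_linear : forall a f g x,
    rkhs_fun (a *: f + g) x = a *: rkhs_fun f x + rkhs_fun g x ;
  rkhs_fun_inj : injective rkhs_fun ;
  rkhs_reproducing : forall x v,
    exists2 h, rkhs_fun h = ksection K x v &
      forall f, dotp (rkhs_fun f x) v = rkhs_dot f h
}.

End Kernels.

(* The law Exp(1), with the structure of probability measure that the library
   gives to [exponential_prob r] for r > 0. *)
Definition Exp1 {R : realType} : probability (measurableTypeR R) R :=
  exponential_distribution_exponential_prob__canonical__probability_measure_Probability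
    (@ltr01 R).

Section Stein.
Context {R : realType} {d : nat}.
Local Notation V := 'rV[R]_d.
Implicit Types (nu : {measure set V -> \bar R}) (P Q : probability V R).

Definition stein_op nu (f : V -> V) (x : V) : R :=
  dotp x (f x) -
  \int[nu]_(s in orthant) \int[Exp1]_e dotp s (f (x + e *: s)).

(* [KSD nu H Q] is the discrepancy between Q and the law G_d(nu). *)
Definition KSD nu (K : V -> V -> 'M[R]_d) (H : vvRKHS K) Q : \bar R :=
  ereal_sup [set `| \int[Q]_y (stein_op nu (rkhs_fun f) y)%:E |%E
            | f in [set f : H | `|f| <= 1]].

Definition statistical_divergence nu P (K : V -> V -> 'M[R]_d) (H : vvRKHS K)
    : Prop :=
  forall Q : probability V R,
    (forall f : H, Q.-integrable setT (EFin \o stein_op nu (rkhs_fun f))) ->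
    (KSD nu H Q = 0%E <-> forall A, measurable A -> Q A = P A).

Definition weak_cvg (Q : nat -> probability V R) P : Prop :=
  forall g : V -> R, continuous g -> bounded_fun g ->
    (fun N => \int[Q N]_x g x) @ \oo --> \int[P]_x g x.

End Stein.

(* Main.v *)
Require Import Defs.
From HB Require Import structures.
From mathcomp Require Import all_boot all_order all_algebra.
From mathcomp Require Import all_classical all_reals all_analysis.
From mathcomp.real_closed Require Import complex.
From mathcomp Require Import measurable_realfun ring lra.
Import Order.TTheory GRing.Theory Num.Theory.
Import numFieldNormedType.Exports.
Local Open Scope classical_set_scope.
Local Open Scope ring_scope.

Set Implicit Arguments.
Unset Strict Implicit.
Unset Printing Implicit Defensive.

(** The laws Q_N are shown to be relatively compact, and every limit point is
identified with P by the divergence hypothesis.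

Compactness comes from moments.  Along a direction t the real part of the
characteristic function of G_d(nu) is exp(-A) cos B with 0 <= A <= b/2 and
|B| <= a, where a and b are the integrals of |<s,t>| and <s,t>^2; hence
E(1 - cos <t,x>) <= (b + a^2)/2, and rescaling t bounds E<t,x>^2 by
2(b + a^2) ([thorin_second_moment], [thorin_enorm_moment]).  The hypothesis on
the nu_N thus bounds the second moments of the Q_N uniformly, so that they are
tight ([tight_of_second_moment]).

Ultrafilters take the place of subsequences: a filter converges to l as soon as
every finer ultrafilter does ([cvg_of_ultra]), and a tight family of laws has a
weak limit along any ultrafilter ([tight_ultra_limit], the compactness half of
Prokhorov's theorem).  The limit is built as a random variable on [0, 1].
Countably many half-spaces cut R^d into a binary tree of cells; the limits p(s)
of the masses of the cells s are additive along the tree, so nested intervals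
of lengths p(s) can be laid out in [0, 1], and almost every point of [0, 1]
follows a branch of cells that shrinks to a point of R^d.  Mass that drifts to
the boundary of the cells is harmless here, since only the points to which the
branches converge matter.

Let now Pl be a limit of the Q_N along an ultrafilter.  Functions f of the RKHS
are bounded and continuous ([rkhs_coord_bounded], [rkhs_coord_continuous]), so
T_nu f is continuous with at most linear growth ([continuous_stein_op],
[stein_op_growth]).  The uniform second moments give the uniform integrability
with which E_{Q_N}[T_nu f] converges to E_{Pl}[T_nu f]
([weak_cvg_linear_growth]); as KSD(Q_N) tends to 0 this limit is 0.  Therefore
KSD(Pl) = 0, whence Pl = P: all limits of the Q_N are equal to P. *)

(** * A random branch in a binary tree of masses *)

Section tree.
Context {R : realType} (p : seq bool -> R).

(** Words are read from right to left, the last choice being the head.  The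
node s receives the interval from left_end s to left_end s + p s: its two
children split that interval, the child [false] on the left. *)
Fixpoint left_end (s : seq bool) : R :=
  if s is b :: s' then left_end s' + (if b then p (false :: s') else 0) else 0.

(** The word of length [n] whose interval contains [w]. *)
Fixpoint branch (n : nat) (w : R) : seq bool :=
  if n is n'.+1 then
    let s := branch n' w in (left_end s + p (false :: s) <= w) :: s
  else [::].

Hypothesis p_nil : p [::] = 1.
Hypothesis p_split : forall s, p s = p (false :: s) + p (true :: s).
Hypothesis p_ge0 : forall s, 0 <= p s.

Lemma size_branch n w : size (branch n w) = n.
Proof. by elim: n => //= n ->. Qed.

Lemma branchE n w s : 0 <= w < 1 -> size s = n ->
  (branch n w == s) = (left_end s <= w < left_end s + p s).
Proof.
move=> w01; elim: n s => [|n IH] [|b s] //=.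
  by rewrite p_nil add0r => _; rewrite w01 eqxx.
move=> [sn]; rewrite eqseq_cons (andbC _ (_ == s)).
have pE := p_split s; have p0 := p_ge0 (false :: s); have p1 := p_ge0 (true :: s).
have [bs|] := boolP (branch n w == s).
  move: (bs); rewrite IH// => /andP[h1 h2]; rewrite (eqP bs) /=.
  case: b.
    rewrite eqb_id; case: leP => //= h; symmetry; lra.
  rewrite eqbF_neg -ltNge addr0 h1 /=; by [].
rewrite IH// => /negP bs /=; apply/esym/negP => /andP[h1 h2].
by apply: bs; case: b h1 h2 => h1 h2; lra.
Qed.

Lemma measurable_branch n s : measurable [set w : R | branch n w = s].
Proof.
elim: n s => [|n IH] [|b s] /=.
- by rewrite (_ : [set _ | _] = setT)//; apply/seteqP; split.
- by rewrite (_ : [set _ | _] = set0)//; apply/seteqP; split.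
- by rewrite (_ : [set _ | _] = set0)//; apply/seteqP; split.
rewrite (_ : [set _ | _] = [set w | branch n w = s] `&`
  (if b then `[left_end s + p (false :: s), +oo[%classic
   else `]-oo, left_end s + p (false :: s)[%classic)); last first.
  apply/seteqP; split => w /=.
    move=> [<- <-]; split => //.
    by case: leP => //= h; rewrite in_itv/= ?h.
  move=> [-> h]; congr (_ :: _); case: b h; rewrite /= in_itv/= ?andbT// => h.
  by rewrite leNgt h.
by apply: measurableI => //; case: b.
Qed.

Lemma uniform_prob01 (A : set R) : measurable A ->
  uniform_prob (@ltr01 R) A = lebesgue_measure (A `&` `[0, 1]%classic).
Proof.
move=> mA; rewrite /uniform_prob integral_uniform_pdf.
rewrite (eq_integral (cst 1%E)); last first.
  by move=> x; rewrite inE => -[_ /=];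
    rewrite /uniform_pdf in_itv/= => ->; rewrite subr0 invr1.
by rewrite integral_cst ?mul1e//; exact: measurableI.
Qed.

Lemma left_end_bounds s : 0 <= left_end s /\ left_end s + p s <= 1.
Proof.
elim: s => [|b s [h1 h2]] /=; first by rewrite p_nil; lra.
have pE := p_split s; have p0 := p_ge0 (false :: s); have p1 := p_ge0 (true :: s).
by case: b; split; lra.
Qed.

(** The interval of s has length p s and lies between 0 and 1; the endpoint
1, which belongs to no interval, has measure zero. *)
Lemma uniform_branch n s : size s = n ->
  uniform_prob (@ltr01 R) [set w : R | branch n w = s] = (p s)%:E.
Proof.
move=> sn; have mB := measurable_branch n s.
rewrite uniform_prob01//.
have -> : [set w : R | branch n w = s] `&` `[0, 1]%classic =
    `[left_end s, left_end s + p s[%classic `|`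
    ([set w : R | branch n w = s] `&` [set 1]).
  have [h1 h2] := left_end_bounds s.
  apply/seteqP; split => w /=; rewrite !in_itv/=.
    move=> [bs /andP[w0]]; rewrite le_eqVlt => /orP[/eqP w1|w1].
      by right; rewrite w1 in bs *.
    by left; rewrite -(branchE (n := n)) ?w0 ?w1// bs.
  move=> [/andP[h3 h4]|[-> ->]]; last by rewrite lexx ler01.
  have w01 : 0 <= w < 1 by apply/andP; split; lra.
  split; last by apply/andP; split; lra.
  by apply/eqP; rewrite branchE// h3.
rewrite -[RHS](_ : lebesgue_measure `[left_end s, left_end s + p s[%classic = _); last first.
  rewrite lebesgue_measure_itv/= lte_fin; case: ifPn => h.
    rewrite -EFinD; congr EFin; ring.
  congr EFin; move: h; rewrite -leNgt gerDl => h; apply/eqP; rewrite eq_le p_ge0 h; done.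
apply/eqP; rewrite eq_le; apply/andP; split.
  apply: (le_trans (measureU2 _ _ _)) => //=; first exact: measurableI.
  rewrite -[leRHS]adde0 leeD2l//.
  rewrite -(lebesgue_measure_set1 (1 : R)); apply: le_measure; rewrite ?inE//.
  exact: measurableI.
apply: le_measure; rewrite ?inE//.
by apply: measurableU => //; exact: measurableI.
Qed.
End tree.

(** * Borel sets of matrices and words of half-space tests *)

Section borel.
Context {R : realType} {m n : nat}.

Lemma open_measurable_mx (A : set 'M[R]_(m, n)) : open A -> measurable A.
Proof. by move=> oA; apply: sub_sigma_algebra. Qed.

Lemma closed_measurable_mx (A : set 'M[R]_(m, n)) : closed A -> measurable A.
Proof.
move=> cA; rewrite -(setCK A); apply: measurableC.
by apply: open_measurable_mx; exact: closed_openC.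
Qed.

Lemma continuous_measurable_mx (f : 'M[R]_(m, n) -> R) :
  continuous f -> measurable_fun setT f.
Proof.
move=> /continuousP cf; apply: (measurability _ (measurable_realfun.RGenOpens.measurableE R)).
move=> _ [_ [a [b ->] <-]]; rewrite setTI; apply: open_measurable_mx.
by apply: cf; exact: interval_open.
Qed.

End borel.

Lemma rv_norm_le (R : realType) d (x : 'rV[R]_d) (r : R) : 0 <= r ->
  (`|x| <= r) <-> (forall i, `|x 0 i| <= r).
Proof.
move=> r0.
have -> : `|x| = \big[Num.max/0]_ij `|x ij.1 ij.2| := mx_normrE x.
  split.
  move=> /bigmax_leP[_ h] i; exact: (h (0, i)).
by move=> h; apply/bigmax_leP; split => // -[i j] _ /=; rewrite (ord1 i).
Qed.

Lemma bounded_integrable d (T : measurableType d) (R : realType)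
    (mu : probability T R) (f : T -> R) (M : R) :
  measurable_fun setT f -> (forall x, `|f x| <= M) ->
  mu.-integrable setT (EFin \o f).
Proof.
move=> mf fM; apply: measurable_bounded_integrable => //.
  by apply: (@le_lt_trans _ _ 1%E); [exact: probability_le1|exact: ltry].
by exists M; split; [exact: num_real|move=> N MN x _ /=; exact: le_trans (fM x) (ltW MN)].
Qed.

(** The compact interval from -M to M contains a cluster point, and an ultrafilter
converges to its cluster points. *)
Lemma ultra_bounded_cvg (I : Type) (F : set_system I) (R : realType) (f : I -> R) (M : R) :
  UltraFilter F -> (forall i, `|f i| <= M) -> exists l : R, f @ F --> l.
Proof.
move=> UF fM; have PF := @ultra_proper _ F UF.
have /(_ (f @ F) _ _)[] := @segment_compact R (- M) M.
  by apply: (@filterE _ F) => i /=; rewrite in_itv/= -ler_norml; exact: fM.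
move=> l [_ cl]; exists l => B Bl.
have [//|nB] := in_ultra_setVsetC (f @^-1` B) UF.
by have [y [nBy By]] := cl (~` B) B nB Bl.
Qed.

Section halfspace_tests.
Context {R : realType} {d : nat}.
Implicit Types x y : 'rV[R]_d.

(** The [j]-th test asks whether a coordinate exceeds a given rational
z / (k + 1); [j] encodes the triple (coordinate, z, k). *)
Definition halfspace_test (j : nat) x : bool :=
  if unpickle j is Some (i, z, k) then
    (z : int)%:~R / (k : nat).+1%:R < x 0 (i : 'I_d)
  else false.

Fixpoint halfspace_word n x : seq bool :=
  if n is n'.+1 then halfspace_test n' x :: halfspace_word n' x else [::].

Lemma size_word n x : size (halfspace_word n x) = n.
Proof. by elim: n => //= n ->. Qed.

Lemma word_eqS n n' x y : (n <= n')%N -> halfspace_word n' x = halfspace_word n' y ->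
  halfspace_word n x = halfspace_word n y.
Proof.
elim: n' => [|n' IH]; first by rewrite leqn0 => /eqP ->.
by rewrite leq_eqVlt ltnS => /orP[/eqP -> //|/IH h] /= [_ /h].
Qed.

Lemma word_test n j x y : (j < n)%N -> halfspace_word n x = halfspace_word n y ->
  halfspace_test j x = halfspace_test j y.
Proof. by move=> jn /(word_eqS jn) /= []. Qed.

Lemma measurable_word n s : measurable [set x | halfspace_word n x = s].
Proof.
elim: n s => [|n IH] [|b s] /=.
- by rewrite (_ : [set _ | _] = setT)//; apply/seteqP; split.
- by rewrite (_ : [set _ | _] = set0)//; apply/seteqP; split.
- by rewrite (_ : [set _ | _] = set0)//; apply/seteqP; split.
rewrite (_ : [set _ | _] =
    [set x | halfspace_test n x = b] `&` [set x | halfspace_word n x = s]); last first.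
  by apply/seteqP; split => x /= [-> ->].
apply: measurableI => //.
suff mt : measurable [set x | halfspace_test n x].
  case: b; first exact: mt.
  rewrite (_ : [set _ | _] = ~` [set x | halfspace_test n x]); first exact: measurableC.
  by apply/seteqP; split => x /=; case: (halfspace_test n x).
rewrite /halfspace_test; case: unpickle => [[[i z] k]|]; last first.
  by rewrite (_ : [set _ | _] = set0)//; apply/seteqP; split.
apply: open_measurable_mx.
apply: (@open_comp _ _ (fun x : 'rV[R]_d => x 0 i) [set r | z%:~R / k.+1%:R < r]).
  by move=> x _; exact: coord_continuous.
exact: open_gt.
Qed.

(** For 1 / (k + 1) < e the finitely many tests with denominator k + 1 and
threshold not much larger than M in absolute value locate each coordinate of a point of
norm at most M in a half-open interval of length 1 / (k + 1), hence any point
with the same answers is e-close to it. *)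
Lemma word_separates (M e : R) : 0 < e -> exists n0, forall n, (n0 <= n)%N ->
  forall x y, `|x| <= M -> halfspace_word n x = halfspace_word n y -> `|x - y| <= e.
Proof.
move=> e0.
have [k ke] : exists k : nat, k.+1%:R^-1 < e.
  exists (Num.truncn e^-1); rewrite -[ltRHS]invrK ltf_pV2 ?posrE ?invr_gt0//.
  exact: truncnS_gt.
(* The integers of [-Z, Z[ contain ceil ((k + 1) x_i) and its predecessor. *)
set Z := (Num.truncn (M * k.+1%:R)).+2.
pose enc (i : 'I_d) (z : int) := pickle (i, z, k).
pose n0 := \max_(t : 'I_d * 'I_(Z + Z)) enc t.1 (t.2%:Z - Z%:Z)%R.
exists n0.+1 => n n0n x y xM xy.
have k0 : 0 < k.+1%:R :> R by [].
have M0 : 0 <= M by apply: le_trans xM.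
apply/rv_norm_le; first exact: ltW.
move=> i; rewrite !mxE.
have testE (z : int) : (- Z%:Z <= z < Z%:Z)%R ->
    (z%:~R / k.+1%:R < x 0 i) = (z%:~R / k.+1%:R < y 0 i).
  move=> /andP[h1 h2].
  have zE : z = (absz (z + Z%:Z)%R)%:Z - Z%:Z by rewrite gez0_abs ?addrK// -lerBlDr sub0r.
  have zlt : (absz (z + Z%:Z)%R < Z + Z)%N.
    by rewrite -ltz_nat gez0_abs ?PoszD ?ltrD2r// -lerBlDr sub0r.
  have := @word_test n (enc i z) x y; rewrite /halfspace_test /enc pickleK; apply => //.
  apply: leq_trans n0n; rewrite ltnS /n0 zE.
  exact: (leq_bigmax (i, Ordinal zlt)).
have /rv_norm_le/(_ i) xiM := xM.
have {xiM} := xiM M0; rewrite ler_norml => /andP[xi1 xi2].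
have /andP[c1 c2] := ceil_itv (x 0 i * k.+1%:R).
set z := Num.ceil (x 0 i * k.+1%:R) in c1 c2.
have MZ : M * k.+1%:R < Z%:R - 1.
  by rewrite /Z -[X in _ < X - 1]natr1 addrK; exact: truncnS_gt.
have xk1 : x 0 i * k.+1%:R <= M * k.+1%:R by rewrite ler_pM2r.
have xk2 : - (M * k.+1%:R) <= x 0 i * k.+1%:R by rewrite -mulNr ler_pM2r.
have zr1 : (z - 1)%:~R < (Z%:Z - 1)%:~R :> R.
  by rewrite [X in _ < X]rmorphB/= -pmulrn; lra.
have zr2 : (- Z%:Z)%:~R < (z - 1)%:~R :> R.
  move: c1 c2; rewrite rmorphB/= rmorphN/= -pmulrn => c1 c2; lra.
rewrite ltr_int in zr1; rewrite ltr_int in zr2.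
have h1 : (z - 1)%:~R / k.+1%:R < y 0 i.
  rewrite -testE ?ltr_pdivrMr//; apply/andP; split; first exact: ltW.
  by apply: lt_trans zr1 _; rewrite ltrBlDr ltrDl.
have h2 : y 0 i <= z%:~R / k.+1%:R.
  rewrite leNgt -testE -?leNgt ?ler_pdivlMr//; apply/andP; split.
    by apply: ltW (lt_trans zr2 _); rewrite ltrBlDr ltrDl.
  by move: zr1; rewrite ltrD2r.
move: c1 c2; rewrite -ltr_pdivrMr// -ler_pdivlMr// => c1 c2.
move: c1 h1; rewrite rmorphB/= mulrBl div1r => c1 h1.
apply: le_trans (ltW ke); move: c1 c2 h1 h2.
move: (z%:~R / k.+1%:R : R) (k.+1%:R^-1 : R) (x 0 i) (y 0 i) => a b u v h1 h2 h3 h4.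
by rewrite ler_norml; apply/andP; split; lra.
Qed.

End halfspace_tests.

(** * Limits of measurable functions and uniform continuity *)

(** Words are countable, so any function of a word is measurable. *)
Lemma measurable_seq_bool d (T : measurableType d) d' (U : measurableType d')
    (W : T -> seq bool) (c : seq bool -> U) :
  (forall s, measurable [set t | W t = s]) -> measurable_fun setT (c \o W).
Proof.
move=> mW _ Y mY; rewrite setTI.
pose A k := if unpickle k is Some s then
  (if `[< Y (c s) >] then [set t | W t = s] else set0) else set0.
rewrite (_ : _ @^-1` _ = \bigcup_k A k).
  apply: bigcupT_measurable => k; rewrite /A; case: unpickle => // s.
  by case: asboolP.
apply/seteqP; split => t /=.
  by move=> Yt; exists (pickle (W t)) => //; rewrite /A pickleK; case: asboolP.
by move=> [k _]; rewrite /A; case: unpickle => // s; case: asboolP => // Ys /= ->.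
Qed.

Lemma Rintegral_seq_bool d (T : measurableType d) (R : realType)
    (mu : probability T R) (n : nat) (W : T -> seq bool) (c : seq bool -> R) :
  (forall t, size (W t) = n) -> (forall s, measurable [set t | W t = s]) ->
  \int[mu]_t c (W t) =
    \sum_(s : n.-tuple bool) c s * fine (mu [set t | W t = s]).
Proof.
move=> sW mW; rewrite /Rintegral.
transitivity (fine (\int[mu]_t (\sum_(s : n.-tuple bool)
    (c s)%:E * (\1_[set t | W t = s] t)%:E))%E).
  congr fine; apply: eq_integral => t _.
  rewrite (bigD1 (Tuple (introT eqP (sW t))))//= big1 ?adde0.
    by rewrite indicE mem_set// mule1.
  move=> s sWt; rewrite indicE memNset ?mule0// => /= Ws.
  by move/eqP: sWt; apply; apply: val_inj.
have mui s : mu.-integrable setT (fun t => (\1_[set t | W t = s] t)%:E).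
  exact: integrable_indic.
rewrite integral_sum//; last by move=> s; exact: integrableZl.
transitivity (fine (\sum_(s : n.-tuple bool) (c s * fine (mu [set t | W t = s]))%:E)).
  congr fine; apply: eq_bigr => s _; rewrite integralZl// integral_indic// setIT EFinM fineK//.
  exact: fin_num_measure.
by rewrite sumEFin.
Qed.

(** The limit of X_k lies in a closed set C if and only if, for every
neighbourhood of C of radius 1 / (k + 1), the sequence eventually enters it. *)
Lemma measurable_lim_mx d (T : measurableType d) (R : realType) (m n : nat)
    (X : nat -> T -> 'M[R]_(m, n)) (Y : T -> 'M[R]_(m, n)) :
  (forall k, measurable_fun setT (X k)) ->
  (forall t, X k t @[k --> \oo] --> Y t) -> measurable_fun setT Y.
Proof.
move=> mX XY.
pose near_set (C : set 'M[R]_(m, n)) (k : nat) :=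
  \bigcup_(c in C) ball c k.+1%:R^-1.
have closedE (C : set 'M[R]_(m, n)) : closed C -> Y @^-1` C =
    \bigcap_k \bigcup_j \bigcap_(i in [set i | (j <= i)%N]) (X i @^-1` near_set C k).
  move=> cC; apply/seteqP; split => t /=.
    move=> CY k _; have : 0 < k.+1%:R^-1 :> R by [].
    move/((cvgrPdist_lt _ _).1 (XY t)) => [j _ jP]; exists j => // i ji.
    by exists (Y t) => //; rewrite -ball_normE; exact: jP.
  move=> h; apply: cC => B /nbhs_ballP[e /= e0 eB].
  have e20 : 0 < e / 2 by rewrite divr_gt0.
  have [k ke] : exists k : nat, k.+1%:R^-1 < e / 2.
    exists (Num.truncn (e / 2)^-1); rewrite -[ltRHS]invrK ltf_pV2 ?posrE ?invr_gt0//.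
    exact: truncnS_gt.
  have [j1 _ j1P] := h k I.
  have [j2 _ j2P] := ((cvgrPdist_lt _ _).1 (XY t)) _ e20.
  have [c Cc cX] := j1P (maxn j1 j2) (leq_maxl _ _).
  exists c; split => //; apply: eB; rewrite (splitr e).
  apply: (@ball_triangle _ _ (X (maxn j1 j2) t)).
    by rewrite -ball_normE; apply: j2P; exact: leq_maxr.
  by apply: ball_sym; apply: le_ball cX; exact: ltW.
have mnear C k : measurable (near_set C k).
  by apply: open_measurable_mx; apply: bigcup_open => c _; exact: ball_open.
apply: (@measurability _ _ _ _ _ _ (@open (matrix R m n)) erefl) => _ [U oU <-]; rewrite setTI.
rewrite -[X in measurable X]setCK; apply: measurableC.
rewrite preimage_setC closedE; last exact: open_closedC.
apply: bigcapT_measurable => k; apply: bigcupT_measurable => j.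
apply: bigcap_measurable; first by exists j => /=.
by move=> i _; rewrite -[X in measurable X]setTI; exact: mX.
Qed.

(** Only one of the two points has to be bounded.  A sequence of
counterexamples clusters at a point where [g] fails to be continuous. *)
Lemma unif_continuous_bounded (R : realType) d (g : 'rV[R]_d -> R) (M e : R) :
  continuous g -> 0 < e -> exists2 r, 0 < r &
    forall x y, `|x| <= M -> `|x - y| <= r -> `|g x - g y| <= e.
Proof.
move=> cg e0; apply: contrapT => nr.
have bad (k : nat) : {xy : 'rV[R]_d * 'rV[R]_d | `|xy.1| <= M /\
    `|xy.1 - xy.2| <= k.+1%:R^-1 /\ e < `|g xy.1 - g xy.2|}.
  apply: cid; apply: contrapT => nxy; apply: nr; exists k.+1%:R^-1 => // x y xM xy.
  by rewrite leNgt; apply/negP => ge; apply: nxy; exists (x, y).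
pose x k := (sval (bad k)).1; pose y k := (sval (bad k)).2.
have cK : compact [set x : 'rV[R]_d | `|x| <= M].
  apply: bounded_closed_compact.
    by exists M; split; [exact: num_real|move=> N MN z /= zM; exact: le_trans zM (ltW MN)].
  apply: (@closed_comp _ _ (fun x : 'rV[R]_d => `|x|) [set r | r <= M]).
    by move=> z _; exact: norm_continuous.
  exact: closed_le.
have [z [_ cz]] := cK (x @ \oo) _ (filterE _ (fun k => (svalP (bad k)).1)).
have e20 : 0 < e / 2 by rewrite divr_gt0.
have : nbhs z [set t | `|g z - g t| < e / 2] by exact: ((cvgrPdist_lt _ _).1 (cg z)).
move=> /nbhs_ballP[r /= r0 rP].
have r20 : 0 < r / 2 by rewrite divr_gt0.
pose N := Num.truncn (r / 2)^-1.
have [_ [[k /= Nk <-] zk]] : ((x @` [set k | (N <= k)%N]) `&` ball z (r / 2)) !=set0.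
  apply: cz; last exact: nbhsx_ballx.
  by exists N => // k /= Nk; exists k.
have [_ [xyk egk]] := svalP (bad k); rewrite -/(x k) -/(y k) in xyk egk.
have kr : k.+1%:R^-1 < r / 2.
  rewrite -[ltRHS]invrK ltf_pV2 ?posrE ?invr_gt0//.
  by apply: lt_le_trans (truncnS_gt _) _; rewrite ler_nat.
rewrite -ball_normE/= in zk.
have h1 : `|g z - g (x k)| < e / 2.
  by apply: rP; rewrite -ball_normE/=; apply: lt_le_trans zk _; lra.
have h2 : `|g z - g (y k)| < e / 2.
  apply: rP; rewrite -ball_normE/=.
  rewrite -(subrKA (x k)) (le_lt_trans (ler_normD _ _))//.
  move: zk xyk kr; move: (k.+1%:R^-1 : R) `|z - x k| `|x k - y k| => a b c; lra.
have := ler_distD (g z) (g (x k)) (g (y k)).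
rewrite (distrC _ (g z)); lra.
Qed.

(** * Weak limits of tight families along an ultrafilter *)

Lemma Rintegral_indic d (T : measurableType d) (R : realType)
    (mu : {measure set T -> \bar R}) (A : set T) :
  measurable A -> \int[mu]_x \1_A x = fine (mu A).
Proof. by move=> mA; rewrite /Rintegral integral_indic// setIT. Qed.

Section prokhorov.
Context {R : realType} {d : nat} {I : Type} (F : set_system I).
Context (Q : I -> probability 'rV[R]_d R).
Hypothesis UF : UltraFilter F.
Hypothesis Q_tight : forall e : R, 0 < e ->
  exists M : R, forall i, (Q i [set x | (M < `|x|)%R] <= e%:E)%E.

Let PF : ProperFilter F := @ultra_proper _ F UF.
Existing Instance PF.

(** The mass that [Q i] gives to the cell of the word [s]. *)
Let cellQ i s := fine (Q i [set x | halfspace_word (size s) x = s]).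

Let p_ex s : exists l : R, (cellQ ^~ s) @ F --> l.
Proof.
apply: (@ultra_bounded_cvg _ F _ _ 1) => // i.
rewrite /cellQ ger0_norm ?fine_ge0// -lee_fin fineK ?probability_le1//.
  exact: measurable_word.
by apply: fin_num_measure; exact: measurable_word.
Qed.

Let p s : R := sval (cid (p_ex s)).

Let p_cvg s : (cellQ ^~ s) @ F --> p s.
Proof. exact: svalP (cid (p_ex s)). Qed.

Let p_nil : p [::] = 1.
Proof.
apply: (cvg_unique (@Rhausdorff R) (@p_cvg [::])).
rewrite (_ : cellQ ^~ [::] = cst 1); first exact: cvg_cst.
apply/funext => i; rewrite /cellQ /=.
by rewrite (_ : [set _ | _] = setT) ?probability_setT//; apply/seteqP; split.
Qed.

Let p_split s : p s = p (false :: s) + p (true :: s).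
Proof.
apply: (cvg_unique (@Rhausdorff R) (@p_cvg s)).
rewrite (_ : cellQ ^~ s = cellQ ^~ (false :: s) \+ cellQ ^~ (true :: s)).
  by apply: cvgD; exact: (@p_cvg).
apply/funext => i /=; rewrite /cellQ.
rewrite -fineD; try by apply: fin_num_measure; exact: measurable_word.
rewrite -measureU; try exact: measurable_word.
  congr (fine (Q i _)); apply/seteqP; split => x /=.
    by move=> ->; case: halfspace_test; [right|left].
  by move=> [] [].
by apply/seteqP; split => x //= [[-> _] []].
Qed.

Let p_ge0 s : 0 <= p s.
Proof.
apply: (closed_cvg (fun r : R => 0 <= r) (@closed_ge R 0) _ _ (@p_cvg s)).
by apply: nearW => i; exact: fine_ge0.
Qed.

Let U : probability (measurableTypeR R) R := uniform_prob (@ltr01 R).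
Let W := branch p.

Let mW n s : measurable [set w : R | W n w = s].
Proof. exact: measurable_branch. Qed.

(** Functions of the first [n] tests take finitely many values, so their means
converge by definition of the limit masses. *)
Let word_cvg n (c : seq bool -> R) :
  (fun i => \int[Q i]_x c (halfspace_word n x)) @ F --> \int[U]_w c (W n w).
Proof.
rewrite (@Rintegral_seq_bool _ _ _ U n (W n) c (size_branch p n) (@mW n)).
rewrite (_ : (fun i => _) = fun i => \sum_(s : n.-tuple bool) c s * cellQ i s); last first.
  apply/funext => i; rewrite (@Rintegral_seq_bool _ _ _ (Q i) n (halfspace_word n)
    c (size_word n) (measurable_word n)).
  by apply: eq_bigr => s _; rewrite /cellQ size_tuple.
apply: cvg_big => [|s _]; [exact: add_continuous|apply: cvgMl_tmp].
have -> : U [set w | W n w = s] = (p s)%:E.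
  by apply: uniform_branch => //; exact: size_tuple.
exact: (@p_cvg).
Qed.

(** A point of the cell of [s], if there is one. *)
Let rep s : 'rV[R]_d := xget 0 [set x | halfspace_word (size s) x = s].

Let word_rep_word n (x : 'rV[R]_d) :
  halfspace_word n (rep (halfspace_word n x)) = halfspace_word n x.
Proof.
have := @xgetPex _ 0 [set y : 'rV[R]_d |
  halfspace_word (size (halfspace_word n x)) y = halfspace_word n x].
by rewrite /rep /= size_word; apply; exists x.
Qed.

(** A branch only meets nodes of positive mass, whose cells are not empty. *)
Let word_rep n w : 0 <= w < 1 -> halfspace_word n (rep (W n w)) = W n w.
Proof.
move=> w01.
have := @branchE R p p_nil p_split p_ge0 n w (W n w) w01 (size_branch _ _ _).
rewrite eqxx => /esym/andP[h1 h2].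
have p0 : 0 < p (W n w) by move: (p (W n w)) h2 => q h2; lra.
have [i ci] : exists i, 0 < cellQ i (W n w).
  have : \forall i \near F, 0 < cellQ i (W n w) by exact: (cvgr_gt _ (@p_cvg _)).
  by move=> /filter_ex.
have : [set x : 'rV[R]_d | halfspace_word (size (W n w)) x = W n w] !=set0.
  apply/set0P/negP => /eqP c0; move: ci; rewrite /cellQ c0 measure0 /=.
  by rewrite ltxx.
have sW : size (W n w) = n := size_branch p n w.
by move=> /(@xgetPex _ 0); rewrite /rep sW.
Qed.

Let word_trunc n n' (x : 'rV[R]_d) w : (n <= n')%N ->
  halfspace_word n' x = W n' w -> halfspace_word n x = W n w.
Proof.
elim: n' => [|n' IH]; first by rewrite leqn0 => /eqP ->.
by rewrite leq_eqVlt ltnS => /orP[/eqP -> //|/IH h] /= [_ /h].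
Qed.

Let level_ex (m : nat) : exists n0, forall n, (n0 <= n)%N ->
  forall x y : 'rV[R]_d, `|x| <= m%:R ->
    halfspace_word n x = halfspace_word n y -> `|x - y| <= 1.
Proof. exact: word_separates. Qed.

(** From this level on, a cell that meets the ball of radius [m] is contained in
the unit ball around any of its points there. *)
Let level m := sval (cid (level_ex m)).

(** The branches that reach a bounded cell at a level fine enough for their
later cells to remain bounded. *)
Let G := `[0, 1[%classic `&` \bigcup_m [set w | `|rep (W (level m) w)| <= m%:R].

Let mG : measurable G.
Proof.
apply: measurableI => //; apply: bigcupT_measurable => m.
have := @measurable_seq_bool _ R _ R (W (level m)) (fun s => `|rep s|) (@mW _).
move=> /(_ measurableT `]-oo, m%:R]%classic (measurable_itv _)).
rewrite setTI; congr measurable; apply/seteqP; split => w /=; rewrite in_itv/=; done.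
Qed.

(** The later representatives lie in a cell met at level [level m], so they stay
in the ball of radius [m + 1], where fine cells are small. *)
Let cauchy_G w : G w -> forall e, 0 < e -> exists N, forall n n',
  (N <= n)%N -> (N <= n')%N -> `|rep (W n w) - rep (W n' w)| <= e.
Proof.
move=> [w01 [m _ /= wm]] e e0.
have {}w01 : 0 <= w < 1 by move: w01; rewrite /= in_itv.
have bnd n : (level m <= n)%N -> `|rep (W n w)| <= m%:R + 1.
  move=> mn; rewrite -(subrK (rep (W (level m) w)) (rep (W n w))) addrC.
  apply: (le_trans (ler_normD _ _)); apply: lerD => //.
  rewrite distrC; apply: (svalP (cid (level_ex m)) (level m)) => //.
  rewrite (word_rep _ w01); apply/esym; apply: (word_trunc mn).
  exact: word_rep.
have [N NP] := @word_separates R d (m%:R + 1) e e0.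
exists (maxn (level m) N) => n n'; rewrite !geq_max => /andP[mn Nn] /andP[mn' Nn'].
apply: (NP N) => //; first exact: bnd.
by rewrite (word_trunc Nn (word_rep n w01)) (word_trunc Nn' (word_rep n' w01)).
Qed.

Let X w : 'rV[R]_d := if w \in G then lim (rep (W n w) @[n --> \oo]) else 0.

Let X_cvg w : G w -> rep (W n w) @[n --> \oo] --> X w.
Proof.
move=> Gw; rewrite /X mem_set//.
apply: cauchy_cvg; apply: cauchy_exP => e e0.
have e20 : 0 < e / 2 by rewrite divr_gt0.
have [N NP] := cauchy_G Gw e20.
exists (rep (W N w)); exists N => // n /= Nn.
by rewrite -ball_normE/=; apply: le_lt_trans (NP N n _ _) _ => //; lra.
Qed.

Let mX : measurable_fun setT X.
Proof.
apply: (@measurable_lim_mx _ R _ _ _ (fun n w => if w \in G then rep (W n w) else 0)).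
  move=> n; apply: measurable_fun_ifT => //.
    apply: (measurable_fun_bool true); rewrite setTI.
    rewrite (_ : _ @^-1` _ = G); first exact: mG.
    by apply/seteqP; split => w /=; [move/set_mem|move/mem_set].
  exact: measurable_seq_bool.
move=> w; case: (boolP (w \in G)) => [wG|nG].
  by apply: X_cvg; exact: set_mem.
by rewrite /X (negbTE nG); exact: cvg_cst.
Qed.

(** Tightness prevents the mass from escaping to infinity.  If [Q i] gives mass
at least 1 - e to the ball of radius [M] for all [i], then the cells whose
representative has norm at most m, with M + 1 <= m, have mass at least 1 - e as
well, and this passes to the limit. *)
Let U_G0 : U (~` G) = 0%E.
Proof.
apply/eqP; rewrite eq_le measure_ge0 andbT; apply/lee_addgt0Pr => e e0; rewrite add0e.
have [M QM] := Q_tight e0.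
pose m := (Num.truncn `|M|).+2; pose n := level m.
have Mm : M + 1 <= m%:R.
  rewrite /m -natr1 lerD2r; apply: (le_trans (ler_norm _)); apply: ltW.
  exact: truncnS_gt.
pose c s : R := (`|rep s| <= m%:R :> R)%R%:R.
pose A : set R := [set w | `|rep (W n w)| <= m%:R].
have mA : measurable A.
  have := @measurable_seq_bool _ R _ R (W n) (fun s => `|rep s|) (@mW _).
  move=> /(_ measurableT `]-oo, m%:R]%classic (measurable_itv _)).
  by rewrite setTI; congr measurable; apply/seteqP; split => w /=; rewrite in_itv/=.
have UA : 1 - e <= fine (U A).
  have <- := @Rintegral_indic _ _ _ U A mA.
  rewrite (_ : Rintegral _ _ _ = \int[U]_w c (W n w)); last first.
    apply: eq_Rintegral => w _; rewrite indicE /c; congr (nat_of_bool _)%:R.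
    by apply/idP/idP => [/set_mem|h]; [|exact/mem_set].
  apply: (closed_cvg (fun r : R => 1 - e <= r) (@closed_ge R _) _ _ (@word_cvg n c)).
  apply: nearW => i.
  pose B := [set x : 'rV[R]_d | `|rep (halfspace_word n x)| <= m%:R].
  have mB : measurable B.
    have := @measurable_seq_bool _ _ _ R (halfspace_word n) (fun s => `|rep s|) (@measurable_word R d _).
    move=> /(_ measurableT `]-oo, m%:R]%classic (measurable_itv _)).
    by rewrite setTI; congr measurable; apply/seteqP; split => w /=; rewrite in_itv/=.
  rewrite (_ : Rintegral _ _ _ = \int[Q i]_x \1_B x); last first.
    apply: eq_Rintegral => w _; rewrite indicE /c; congr (nat_of_bool _)%:R.
    by apply/idP/idP => [h|/set_mem]; [exact/mem_set|].
  rewrite Rintegral_indic// -lee_fin fineK ?fin_num_measure//.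
  have mM : measurable [set x : 'rV[R]_d | M < `|x|].
    apply: open_measurable_mx.
    apply: (@open_comp _ _ (fun x : 'rV[R]_d => `|x|) [set r | M < r]).
      by move=> z _; exact: norm_continuous.
    exact: open_gt.
  apply: (@le_trans _ _ (Q i (~` [set x | (M < `|x|)%R]))).
    rewrite probability_setC// EFinB leeB//; exact: QM.
  apply: le_measure; rewrite ?inE//; first exact: measurableC.
  move=> x /= /negP; rewrite -leNgt => xM.
  have : `|x - rep (halfspace_word n x)| <= 1.
    apply: (svalP (cid (level_ex m)) n) => //.
    by apply: (le_trans xM); apply: le_trans Mm; rewrite lerDl.
  move=> h; rewrite /B/= -(subrK x (rep (halfspace_word n x))).
  by apply: (le_trans (ler_normD _ _)); apply: le_trans Mm; rewrite addrC lerD// distrC.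
pose J : set R := `[0, 1[%classic.
have mJ : measurable (J : set (measurableTypeR R)) by exact: measurable_itv.
apply: (@le_trans _ _ (U (~` J) + U (~` A))%E).
  apply: le_trans (measureU2 _ _ _); try exact: measurableC.
  apply: le_measure; rewrite ?inE; [exact: measurableC|by apply: measurableU; exact: measurableC|].
  rewrite -setCI; apply: subsetC => w [w01 Aw]; split => //.
  by exists m.
have -> : U (~` J) = 0%E.
  rewrite /U/= uniform_prob01; last exact: measurableC.
  apply/eqP; rewrite eq_le measure_ge0 andbT -(lebesgue_measure_set1 (1 : R)).
  apply: le_measure; rewrite ?inE//; first by apply: measurableI => //; exact: measurableC.
  move=> w [] /= /negP; rewrite !in_itv/= => h1 /andP[w0 w1].
  by apply/eqP; rewrite eq_le w1 leNgt; move: h1; rewrite w0.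
rewrite add0e probability_setC// -[U A]fineK ?fin_num_measure// -EFinB lee_fin.
move: UA; move: (fine _) => q; lra.
Qed.

(** The Borel sigma-algebra of [R] is the one on which [U] is a measure. *)
Let mX' : @measurable_fun _ _ (measurableTypeR R) 'rV[R]_d setT X.
Proof. exact: mX. Qed.

Let XRV : {mfun (measurableTypeR R) >-> 'rV[R]_d} :=
  HB.pack X (@isMeasurableFun.Build _ _ (measurableTypeR R) 'rV[R]_d X mX').

Let Qlim : probability 'rV[R]_d R := distribution U XRV.

(** The approximation is uniform in [i]: inside a large ball [g] is uniformly
continuous and the cells are small, and outside of it the bound [C] is
multiplied by a small mass. *)
Let step_approx (g : 'rV[R]_d -> R) (C e : R) : continuous g ->
  (forall x, `|g x| <= C) -> 0 < e -> exists N, forall n i, (N <= n)%N ->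
  `|\int[Q i]_x g x - \int[Q i]_x g (rep (halfspace_word n x))| <= e.
Proof.
move=> cg gC e0.
have e20 : 0 < e / 2 by rewrite divr_gt0.
have C0 : 0 <= C by apply: le_trans (gC 0).
have e40 : 0 < e / 2 / (2 * C + 1) by rewrite divr_gt0//; lra.
have [M QM] := Q_tight e40.
have [r r0 gr] := unif_continuous_bounded M cg e20.
have [N NP] := @word_separates R d M r r0.
exists N => n i Nn.
have mg := continuous_measurable_mx cg.
have mgw : measurable_fun setT (fun x : 'rV[R]_d => g (rep (halfspace_word n x))).
  have h := @measurable_seq_bool _ _ _ R (halfspace_word n) (g \o rep)
    (@measurable_word R d _).
  exact: h.
have ig := bounded_integrable (Q i) mg gC.
have igw : (Q i).-integrable setT (EFin \o (fun x => g (rep (halfspace_word n x)))).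
  exact: (bounded_integrable (Q i) mgw (fun x => gC _)).
pose B := [set x : 'rV[R]_d | M < `|x|].
have mB : measurable B.
  apply: open_measurable_mx.
  apply: (@open_comp _ _ (fun x : 'rV[R]_d => `|x|) [set r | M < r]).
    by move=> z _; exact: norm_continuous.
  exact: open_gt.
have mdom : measurable_fun setT (fun x => e / 2 + 2 * C * \1_B x : R).
  by apply: measurable_funD => //; apply: measurable_funM.
have mdiff : measurable_fun setT (fun x : 'rV[R]_d => g x - g (rep (halfspace_word n x))).
  exact: measurable_funB.
have diffC x : `|g x - g (rep (halfspace_word n x))| <= C + C.
  by rewrite (le_trans (ler_normB _ _))// lerD.
rewrite -RintegralB//.
apply: le_trans (le_normr_Rintegral _ _) _ => //.
  exact: (bounded_integrable (Q i) mdiff diffC).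
apply: (@le_trans _ _ (\int[Q i]_x (e / 2 + 2 * C * \1_B x))).
  apply: le_Rintegral => //.
  - apply: (@bounded_integrable _ _ _ _ _ (C + C)).
      exact: measurableT_comp.
    by move=> x; rewrite normr_id.
  - apply: (@bounded_integrable _ _ _ _ _ (e / 2 + 2 * C)) => // x.
    by rewrite indicE; case: (x \in B); rewrite ?mulr1 ?mulr0 ger0_norm; lra.
  - move=> x _; rewrite indicE; have [xB|xB] := boolP (x \in B); rewrite ?mulr1 ?mulr0.
      by apply: le_trans (diffC x) _; lra.
    rewrite addr0; apply: gr.
      by move/negP: xB; rewrite leNgt => h; apply/negP => h1; apply: h; exact/mem_set.
    apply: (NP n) => //.
      by move/negP: xB; rewrite leNgt => h; apply/negP => h1; apply: h; exact/mem_set.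
have iB := integrable_indic (Q i) mB.
rewrite RintegralD//; last 2 first.
- exact: (@bounded_integrable _ _ _ _ _ `|e / 2|).
- apply: (@bounded_integrable _ _ _ _ _ (2 * C)); first exact: measurable_funM.
  by move=> x; rewrite indicE; case: (x \in B); rewrite ?mulr1 ?mulr0 ger0_norm; lra.
rewrite Rintegral_cst// (_ : fine _ = 1); last exact: (congr1 fine (probability_setT (Q i))).
rewrite mulr1 RintegralZl//.
have -> := @Rintegral_indic _ _ _ (Q i) B mB.
have : fine (Q i B) <= e / 2 / (2 * C + 1).
  by rewrite -lee_fin fineK ?fin_num_measure//; exact: QM.
rewrite ler_pdivlMr; last lra.
have := fine_ge0 (measure_ge0 (Q i) B); move: (fine _) => q q0 qe.
nra.
Qed.

(** Two approximations by functions of the first [n] words, one for [Q i],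
uniform in [i], and one for the limit law, by dominated convergence along the
branches, are matched by the convergence of the masses of the cells. *)
Lemma tight_ultra_limit : exists P : probability 'rV[R]_d R,
  forall g : 'rV[R]_d -> R, continuous g -> bounded_fun g ->
    (fun i => \int[Q i]_x g x) @ F --> \int[P]_x g x.
Proof.
exists Qlim => g cg bg.
have [C gC] : exists C, forall x, `|g x| <= C.
  case: bg => C [_ gC]; exists (C + 1) => x.
  by apply: (gC (C + 1)) => //; rewrite ltrDl.
have mg := continuous_measurable_mx cg.
have -> : \int[Qlim]_x g x = \int[U]_w g (X w).
  rewrite /Rintegral integral_distribution//.
    exact/measurable_EFinP.
  apply: (@bounded_integrable _ _ _ _ _ C); last by move=> w; exact: gC.
  exact: (measurableT_comp mg mX).
have steps : (fun n => \int[U]_w g (rep (W n w))) @ \oo --> \int[U]_w g (X w).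
  have mgW n : measurable_fun setT (fun w => g (rep (W n w))).
    exact: (@measurable_seq_bool _ R _ _ (W n) (g \o rep) (@mW n)).
  have [//| | | | |_ _ h] := @dominated_convergence _ _ _ U setT measurableT
     (fun n w => (g (rep (W n w)))%:E) (fun w => (g (X w))%:E) (cst C%:E).
  - by move=> n; apply/measurable_EFinP; exact: mgW.
  - by apply/measurable_EFinP; exact: (measurableT_comp mg mX).
  - exists (~` G); split; [exact: measurableC|exact: U_G0|].
    move=> w /= nw Gw; apply: nw => _; apply: cvg_EFin; first exact: nearW.
    apply: (@cvg_comp _ _ _ (fun n => rep (W n w)) g _ (nbhs (X w))); last exact: cg.
    exact: X_cvg.
  - exact: (finite_measure_integrable_cst U C).
  - by apply: aeW => w n _; rewrite lee_fin; exact: gC.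
  apply: fine_cvg; rewrite fineK; first exact: h.
  apply: integrable_fin_num => //.
  apply: (@bounded_integrable _ _ _ _ _ C); last by move=> w; exact: gC.
  exact: (measurableT_comp mg mX).
apply/cvgrPdist_le => e e0.
have e30 : 0 < e / 3 by rewrite divr_gt0.
have [N NP] := step_approx cg gC e30.
have [N' _ N'P] := (cvgrPdist_le _ _).1 steps _ e30.
pose n := maxn N N'.
have hF := (cvgrPdist_le _ _).1 (@word_cvg n (g \o rep)) _ e30.
have hF2 : F (fun i => `|\int[U]_w g (rep (W n w)) -
    \int[Q i]_x g (rep (halfspace_word n x))| <= e / 3).
  by exact: hF.
apply: filterS hF2 => i /= h1.
have h2 := N'P n (leq_maxr _ _).
have h3 := NP n i (leq_maxl _ _).
rewrite /= in h2.
move: h1 h2 h3; rewrite !ler_norml => /andP[? ?] /andP[? ?] /andP[? ?].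
by apply/andP; split; lra.
Qed.

End prokhorov.

(** * Second moments of the laws G_d(nu) *)

Section trigonometric_bounds.
Context {R : realType}.
Implicit Types x y : R.

Lemma sin_mvt x : 0 <= x -> exists2 c, c \in `[0, x] & sin x = cos c * x.
Proof.
move=> x0.
have [c cx h] := @MVT_segment R sin cos 0 x x0
  (fun z _ => is_derive_sin z) (continuous_subspaceT (@continuous_sin R)).
by exists c => //; rewrite sin0 !subr0 in h.
Qed.

Lemma one_sub_cosE x : 1 - cos x = 2 * sin (x / 2) ^+ 2.
Proof.
have {1}-> : x = (x / 2) *+ 2 by rewrite -mulr_natr; field.
by rewrite cos_mulr2n cos2sin2 -mulr_natl; ring.
Qed.

Lemma one_sub_cos_le x : 1 - cos x <= x ^+ 2 / 2.
Proof.
wlog x0 : x / 0 <= x.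
  by move=> h; case: (leP 0 x) => [/h//|xn]; rewrite -cosN -sqrrN h// oppr_ge0 ltW.
have y0 : 0 <= x / 2 by lra.
have [c _ sE] := sin_mvt y0.
rewrite one_sub_cosE sE exprMn.
have : cos c ^+ 2 <= 1 by rewrite cos2sin2 gerBl sqr_ge0.
have := sqr_ge0 x; rewrite expr_div_n; nra.
Qed.

Lemma one_sub_cos_ge x : `|x| <= 1 -> x ^+ 2 / 4 <= 1 - cos x.
Proof.
wlog x0 : x / 0 <= x.
  move=> h; case: (leP 0 x) => [/h//|xn]; rewrite -cosN -sqrrN -normrN.
  by apply: h; rewrite oppr_ge0 ltW.
rewrite ger0_norm// => x1.
have y0 : 0 <= x / 2 by lra.
have [c] := sin_mvt y0; rewrite in_itv/= => /andP[c0 c1] sE.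
rewrite one_sub_cosE sE exprMn.
have := one_sub_cos_le c => cc.
have c2 : c ^+ 2 <= 1 / 4 by rewrite expr2; nra.
have cosc : 7 / 8 <= cos c by lra.
have : (7 / 8) ^+ 2 <= cos c ^+ 2 by rewrite lerXn2r// nnegrE; lra.
have := sqr_ge0 x; rewrite expr_div_n; nra.
Qed.

Lemma normr_atan_le x : `|atan x| <= `|x|.
Proof.
wlog x0 : x / 0 <= x.
  move=> h; case: (leP 0 x) => [/h//|xn]; rewrite -(normrN x) -(normrN (atan x)) -atanN.
  by apply: h; rewrite oppr_ge0 ltW.
have [c cx] := @MVT_segment R atan (fun x => (1 + x ^+ 2)^-1) 0 x x0
  (fun z _ => is_derive1_atan z)
  (continuous_subspaceT (@continuous_atan R)).
rewrite atan0 !subr0 => ->; rewrite normrM ler_piMl//.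
have c2 := sqr_ge0 c.
by rewrite ger0_norm ?invr_ge0 ?invf_le1; lra.
Qed.

End trigonometric_bounds.

Section log_of_characteristic.
Context {R : realType}.

(** On the line Re z = 1 the principal argument of 1 - iy is - atan y. *)
Lemma logC_1iE (y : R) : logC (1 - 'i%C * ((y%:C)%C)) =
  (ln (Num.sqrt (1 + y ^+ 2)) +i* (- atan y))%C.
Proof.
have -> : (1 - 'i%C * (y%:C)%C) = (1 +i* (- y))%C :> R[i].
  by apply/eqP; rewrite eq_complex /=; apply/andP; split; apply/eqP; ring.
rewrite /logC /argC /= expr1n sqrrN mul1r oppr_ge0.
set q := Num.sqrt (1 + y ^+ 2).
have qE : q^-1 = cos (atan y) by rewrite cos_atan.
have pi2 := pihalf_ge1 R; have ub := atan_ltpi2 y; have lb := atan_gtNpi2 y.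
rewrite qE; case: leP => y0.
  have a0 : atan y <= 0 by rewrite -(@atan0 R) le_atan.
  by rewrite cosKN//; apply/andP; split => //; lra.
have a0 : 0 <= atan y by rewrite -(@atan0 R) le_atan// ltW.
by rewrite cosK// in_itv/=; apply/andP; split => //; lra.
Qed.

Lemma expC_iE (y : R) : expC ('i%C * ((y%:C)%C)) = (cos y +i* sin y)%C.
Proof.
rewrite /expC /=; have -> : 0 * y - 1 * 0 = 0 by ring.
by have -> : 0 * 0 + 1 * y = y; [ring|rewrite expR0 !mul1r].
Qed.

(** The real part of exp(-A + iB) is exp(-A) cos B. *)
Lemma Re_char_fun_thorin d (nu : {measure set 'rV[R]_d -> \bar R})
    (P : probability 'rV[R]_d R) (t : 'rV[R]_d) : thorin_law nu P ->
  \int[P]_x cos (dotp t x) =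
    expR (- \int[nu]_(s in orthant) ln (Num.sqrt (1 + dotp s t ^+ 2))) *
    cos (\int[nu]_(s in orthant) - atan (dotp s t)).
Proof.
move=> [_ /(_ t)].
have -> : char_fun P t =
    ((\int[P]_x cos (dotp t x)) +i* (\int[P]_x sin (dotp t x)))%C.
  by rewrite /char_fun /integralC; congr (_ +i* _)%C; apply: eq_Rintegral => x _;
    rewrite expC_iE.
have -> : thorin_exponent nu t =
    (- ((\int[nu]_(s in orthant) ln (Num.sqrt (1 + dotp s t ^+ 2))) +i*
        (\int[nu]_(s in orthant) - atan (dotp s t))))%C.
  rewrite /thorin_exponent /integralC; congr (- (_ +i* _))%C;
    by apply: eq_Rintegral => s _; rewrite logC_1iE.
move: (Rintegral _ _ _) (Rintegral _ _ _) (Rintegral _ _ _) (Rintegral _ _ _).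
by move=> C S A B /(congr1 (@complex.Re R)); rewrite /expC /= cosN.
Qed.
End log_of_characteristic.

Lemma Rintegral_abs_le d (T : measurableType d) (R : realType)
    (mu : {measure set T -> \bar R}) (D : set T) (f g : T -> R) (c : R) :
  measurable D -> measurable_fun D f -> measurable_fun D g ->
  (forall x, D x -> `|f x| <= g x) ->
  (\int[mu]_(x in D) (g x)%:E <= c%:E)%E -> `|\int[mu]_(x in D) f x| <= c.
Proof.
move=> mD mf mg fg gc.
have fc : (`|\int[mu]_(x in D) (f x)%:E| <= c%:E)%E.
  apply: (le_trans (le_abse_integral _ _ _)) => //; first exact/measurable_EFinP.
  apply: le_trans gc; apply: ge0_le_integral => //=.
  - by apply/measurable_EFinP; exact: measurableT_comp.
  - exact/measurable_EFinP.
rewrite /Rintegral -lee_fin; move: fc; case: (\int[mu]_(x in D) (f x)%:E)%E => //=.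
Qed.

Section second_moment.
Context {R : realType} {d : nat}.

Lemma continuous_dotpr (t : 'rV[R]_d) : continuous (dotp t).
Proof.
move=> x; apply: (@cvg_big _ _ _ _ _ _ _ (nbhs x)) => [|i _].
  exact: add_continuous.
by apply: cvgMl_tmp; exact: coord_continuous.
Qed.

Lemma dotpC (x y : 'rV[R]_d) : dotp x y = dotp y x.
Proof. by apply: eq_bigr => i _; rewrite mulrC. Qed.

Lemma measurable_orthant : measurable (@orthant R d).
Proof.
apply: closed_measurable_mx.
rewrite (_ : orthant = \bigcap_(i in setT) [set u : 'rV[R]_d | 0 <= u 0 i]); last first.
  by apply/seteqP; split => u h i; [move=> _|]; apply: h.
apply: closed_bigI => i _.
apply: (@closed_comp _ _ (fun x : 'rV[R]_d => x 0 i) [set r | 0 <= r]).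
  by move=> x _; exact: coord_continuous.
exact: closed_ge.
Qed.

(** The second-order behaviour of the characteristic function at 0 controls the
second moment.  If -A + iB is the exponent at u t, the inequality 1 - exp(-A) cos B <= A + B^2 / 2 bounds the mean of
1 - cos (u <t,x>) by u^2 (b + a^2) / 2.  As y^2 / 4 <= 1 - cos y for |y| <= 1,
taking u of order 1 / n bounds the second moment truncated at n, uniformly
in n. *)
Lemma thorin_second_moment (nu : {measure set 'rV[R]_d -> \bar R})
    (P : probability 'rV[R]_d R) (t : 'rV[R]_d) (a b : R) :
  thorin_law nu P ->
  (\int[nu]_(s in orthant) (`|dotp s t|)%:E <= a%:E)%E ->
  (\int[nu]_(s in orthant) (dotp s t ^+ 2)%:E <= b%:E)%E ->
  (\int[P]_x (dotp t x ^+ 2)%:E <= (2 * (b + a ^+ 2))%:E)%E.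
Proof.
move=> nuP ia ib.
have mO := measurable_orthant.
have md : measurable_fun setT (fun s : 'rV[R]_d => dotp s t).
  by under eq_fun do rewrite dotpC; apply: continuous_measurable_mx; exact: continuous_dotpr.
have cosb (u : R) : 0 < u -> \int[P]_x (1 - cos (u * dotp t x)) <= u ^+ 2 * (b + a ^+ 2) / 2.
  move=> u0.
  have mu_d : measurable_fun setT (fun s : 'rV[R]_d => u * dotp s t).
    exact: measurable_funM.
  have uE s : dotp s (u *: t) = u * dotp s t.
    by rewrite /dotp mulr_sumr; apply: eq_bigr => i _; rewrite mxE mulrCA.
  have intcos := Re_char_fun_thorin (u *: t) nuP.
  have mcos : measurable_fun setT (fun x : 'rV[R]_d => cos (u * dotp t x)).
    apply: measurableT_comp; first exact: continuous_measurable_fun (@continuous_cos R).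
    by under eq_fun do rewrite dotpC.
  have ic : P.-integrable setT (EFin \o (fun x : 'rV[R]_d => cos (u * dotp t x))).
    by apply: (bounded_integrable P mcos (M := 1)) => x; rewrite ler_norml cos_geN1 cos_le1.
  rewrite RintegralB//; last by apply: (bounded_integrable P (M := 1)) => // x; rewrite normr1.
  rewrite Rintegral_cst// (_ : fine _ = 1); last exact: (congr1 fine (probability_setT P)).
  rewrite mulr1 (_ : Rintegral _ _ _ = \int[P]_x cos (dotp (u *: t) x)); last first.
    by apply: eq_Rintegral => x _; rewrite (dotpC (u *: t)) uE dotpC.
  rewrite intcos.
  set A := Rintegral _ _ _; set B := Rintegral _ _ _.
  have A0 : 0 <= A.
    apply: Rintegral_ge0 => s _; apply: ln_ge0.
    by rewrite -[leLHS]sqrtr1 ler_wsqrtr// lerDl sqr_ge0.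
  have Ab : `|A| <= u ^+ 2 / 2 * b.
    apply: (@Rintegral_abs_le _ _ _ nu orthant _ (fun s => u ^+ 2 / 2 * dotp s t ^+ 2)) => //.
    - apply: measurable_funTS; apply: measurableT_comp; first exact: measurable_ln.
      apply: measurableT_comp; first exact: continuous_measurable_fun (@sqrt_continuous R).
      apply: measurable_funD => //; apply: measurable_funX.
      by under eq_fun do rewrite uE.
    - by apply: measurable_funTS; apply: measurable_funM => //; exact: measurable_funX.
    - move=> s _; rewrite uE; have y2 := sqr_ge0 (u * dotp s t).
      have s1 : 1 <= Num.sqrt (1 + (u * dotp s t) ^+ 2).
        by rewrite -[leLHS]sqrtr1 ler_wsqrtr// lerDl.
      rewrite ger0_norm ?ln_ge0//.
      apply: le_trans (_ : ln (1 + (u * dotp s t) ^+ 2 / 2) <= _).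
        rewrite ler_ln ?posrE; [|lra|lra].
        rewrite -[leRHS]ger0_norm -?sqrtr_sqr; last lra.
        by rewrite ler_wsqrtr//; move: y2; move: (_ ^+ 2) => y y0; nra.
      apply: (le_trans (le_ln1Dx _)); first lra.
      by rewrite exprMn; lra.
    - under eq_integral do rewrite EFinM.
      rewrite ge0_integralZl//.
      + by rewrite [leRHS]EFinM lee_pmul2l// lte_fin divr_gt0// exprn_gt0.
      + by apply/measurable_EFinP/measurable_funTS; exact: measurable_funX.
      + by move=> s _; rewrite lee_fin sqr_ge0.
      + by rewrite lee_fin divr_ge0// sqr_ge0.
  have Bb : `|B| <= u * a.
    apply: (@Rintegral_abs_le _ _ _ nu orthant _ (fun s => u * `|dotp s t|)) => //.
    - apply: measurable_funTS; apply: measurable_funN.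
      apply: measurableT_comp; last by under eq_fun do rewrite uE.
      exact: continuous_measurable_fun (@continuous_atan R).
    - by apply: measurable_funTS; apply: measurable_funM => //; exact: measurableT_comp.
    - by move=> s _; rewrite normrN (le_trans (normr_atan_le _))// uE normrM gtr0_norm.
    - under eq_integral do rewrite EFinM.
      rewrite ge0_integralZl//.
      + by rewrite [leRHS]EFinM lee_pmul2l// lte_fin divr_gt0// exprn_gt0.
      + by apply/measurable_EFinP/measurable_funTS; exact: measurableT_comp.
      + by rewrite lee_fin; exact: ltW.
  have eA := expR_ge1Dx (- A).
  have eA1 : expR (- A) <= 1 by rewrite expR_le1 oppr_le0.
  have eA0 := expR_gt0 (- A).
  have cB := one_sub_cos_le B.
  have cB1 := cos_le1 B.
  have B2 : B ^+ 2 <= (u * a) ^+ 2.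
    by rewrite -[leLHS]real_normK ?num_real// lerXn2r// nnegrE (le_trans _ Bb).
  have AbA : A <= u ^+ 2 / 2 * b by rewrite (le_trans (ler_norm A)).
  move: eA eA1 eA0 cB cB1 B2 AbA; rewrite exprMn.
  move: (expR _) (cos B) (B ^+ 2) (u ^+ 2) (a ^+ 2) => E c B2 u2 a2 *.
  by nra.
have mDn (n : nat) : measurable [set x : 'rV[R]_d | `|dotp t x| <= n%:R].
  apply: closed_measurable_mx.
  apply: (@closed_comp _ _ (fun x : 'rV[R]_d => `|dotp t x|) [set r | r <= n%:R]).
    move=> z _; apply: (@continuous_comp _ _ _ (dotp t) Num.norm).
      exact: continuous_dotpr.
    exact: norm_continuous.
  exact: closed_le.
have trunc_bound (n : nat) :
    (\int[P]_(x in [set x | (`|dotp t x| <= n%:R)%R]) (dotp t x ^+ 2)%:E <=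
     (2 * (b + a ^+ 2))%:E)%E.
  (* Where |<t,x>| <= n, the angle u <t,x> is at most 1. *)
  pose u : R := n.+1%:R^-1.
  have u0 : 0 < u by rewrite invr_gt0.
  pose D := [set x : 'rV[R]_d | `|dotp t x| <= n%:R].
  have mdt : measurable_fun setT (dotp t).
    by apply: continuous_measurable_mx; exact: continuous_dotpr.
  have mD : measurable D by exact: mDn.
  have m1c : measurable_fun setT (fun x : 'rV[R]_d => 1 - cos (u * dotp t x)).
    apply: measurable_funB => //; apply: measurableT_comp.
      exact: continuous_measurable_fun (@continuous_cos R).
    exact: measurable_funM.
  have c2 x : 0 <= 1 - cos x :> R by rewrite subr_ge0 cos_le1.
  have i1c : P.-integrable setT (EFin \o (fun x : 'rV[R]_d => 1 - cos (u * dotp t x))).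
    apply: (bounded_integrable P m1c (M := 2)) => x.
    by rewrite ger0_norm//; have := cos_geN1 (u * dotp t x); lra.
  have k0 : 0 < 4 / u ^+ 2 by rewrite divr_gt0// exprn_gt0.
  apply: (@le_trans _ _ (\int[P]_(x in D) ((4 / u ^+ 2)%:E * (1 - cos (u * dotp t x))%:E))%E).
    apply: ge0_le_integral => //.
    - by move=> x _; rewrite lee_fin sqr_ge0.
    - by apply/measurable_EFinP/measurable_funTS; exact: measurable_funX.
    - by apply/measurable_EFinP/measurable_funTS; exact: measurable_funM.
    - move=> x Dx; rewrite lee_fin.
      have ux : `|u * dotp t x| <= 1.
        rewrite normrM gtr0_norm// mulrC ler_pdivrMr// mul1r (le_trans Dx)//.
        by rewrite ler_nat.
      have := one_sub_cos_ge ux; rewrite exprMn => h.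
      rewrite -[leLHS](_ : 4 / u ^+ 2 * (u ^+ 2 * dotp t x ^+ 2 / 4) = _).
        by rewrite ler_pM2l.
      by field; rewrite gt_eqF.
  apply: (@le_trans _ _ (\int[P]_x ((4 / u ^+ 2)%:E * (1 - cos (u * dotp t x))%:E))%E).
    apply: ge0_subset_integral => //.
    - by apply/measurable_EFinP; exact: measurable_funM.
    - by move=> x _; rewrite lee_fin mulr_ge0// ltW.
  rewrite integralZl//.
  rewrite -[X in (_ * X)%E]fineK; last exact: integrable_fin_num.
  rewrite -EFinM lee_fin.
  apply: (@le_trans _ _ (4 / u ^+ 2 * (u ^+ 2 * (b + a ^+ 2) / 2))).
    by rewrite ler_pM2l//; exact: cosb.
  by rewrite le_eqVlt; apply/orP; left; apply/eqP; field; rewrite gt_eqF.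
pose D (n : nat) := [set x : 'rV[R]_d | `|dotp t x| <= n%:R].
have DT : \bigcup_n D n = setT.
  apply/seteqP; split => // x _; exists (Num.truncn `|dotp t x|).+1 => //=.
  by apply: ltW; exact: truncnS_gt.
have h : (\int[P]_(x in D n) (dotp t x ^+ 2)%:E)%E @[n --> \oo] -->
    (\int[P]_x (dotp t x ^+ 2)%:E)%E.
  rewrite -DT; apply: ge0_nondecreasing_set_cvg_integral => //.
  - move=> n m nm; apply/subsetPset => x Dx; apply: (le_trans Dx).
    by rewrite ler_nat.
  - move=> n; apply/measurable_EFinP/measurable_funTS; apply: measurable_funX.
    by apply: continuous_measurable_mx; exact: continuous_dotpr.
  - by move=> n x _; rewrite lee_fin sqr_ge0.
rewrite -(cvg_lim _ h)//.
apply: lime_le; first by apply/cvg_ex; eexists; exact: h.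
by apply: nearW => n; exact: trunc_bound.
Qed.
End second_moment.

Section euclidean.
Context {R : realType} {d : nat}.
Implicit Types x s : 'rV[R]_d.

Lemma enorm_ge0 x : 0 <= enorm x. Proof. exact: sqrtr_ge0. Qed.

Lemma enorm_sqr x : enorm x ^+ 2 = \sum_(i < d) x 0 i ^+ 2.
Proof.
rewrite sqr_sqrtr; last by apply: sumr_ge0 => i _; exact: sqr_ge0.
by apply: eq_bigr => i _; rewrite expr2.
Qed.

Lemma coord_le_enorm x i : `|x 0 i| <= enorm x.
Proof.
rewrite -(ler_pXn2r (n := 2))// ?nnegrE ?enorm_ge0//.
rewrite enorm_sqr real_normK ?num_real// (bigD1 i)//= lerDl.
by apply: sumr_ge0 => j _; exact: sqr_ge0.
Qed.

Lemma norm_le_enorm x : `|x| <= enorm x.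
Proof. by apply/rv_norm_le; [exact: enorm_ge0|exact: coord_le_enorm]. Qed.

Lemma continuous_enorm : continuous (@enorm R d).
Proof.
move=> x; apply: (@continuous_comp _ _ _ (fun x : 'rV[R]_d => dotp x x) Num.sqrt).
  apply: (@cvg_big _ _ _ _ _ _ _ (nbhs x)) => [|i _].
    exact: add_continuous.
  by apply: cvgM; exact: coord_continuous.
exact: sqrt_continuous.
Qed.

Lemma measurable_enorm : measurable_fun setT (@enorm R d).
Proof. exact: continuous_measurable_mx continuous_enorm. Qed.

Lemma dotp_delta s i : dotp s (delta_mx 0 i) = s 0 i.
Proof.
rewrite /dotp (bigD1 i)//= big1 ?addr0 => [|j ji]; first by rewrite mxE !eqxx mulr1.
by rewrite mxE (negbTE ji) andbF mulr0.
Qed.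

(** Sum of the bounds along the coordinate axes. *)
Lemma thorin_enorm_moment (nu : {measure set 'rV[R]_d -> \bar R})
    (P : probability 'rV[R]_d R) (M : R) :
  thorin_law nu P ->
  (\int[nu]_(s in orthant) (enorm s + enorm s ^+ 2)%:E <= M%:E)%E ->
  (\int[P]_x (enorm x ^+ 2)%:E <= (d%:R * (2 * (M + M ^+ 2)))%:E)%E.
Proof.
move=> nuP nuM.
have mO := @measurable_orthant R d.
have mcoord i : measurable_fun setT (fun s : 'rV[R]_d => s 0 i).
  by apply: continuous_measurable_mx => x; exact: coord_continuous.
have mM : measurable_fun setT (fun s : 'rV[R]_d => enorm s + enorm s ^+ 2).
  by apply: measurable_funD; [|apply: measurable_funX]; exact: measurable_enorm.
have coordM i : (\int[P]_x (x 0 i ^+ 2)%:E <= (2 * (M + M ^+ 2))%:E)%E.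
  have -> : (\int[P]_x (x 0 i ^+ 2)%:E = \int[P]_x (dotp (delta_mx 0 i) x ^+ 2)%:E)%E.
    by apply: eq_integral => x _; rewrite dotpC dotp_delta.
  apply: (thorin_second_moment nuP); apply: le_trans nuM; apply: ge0_le_integral => //.
  - under eq_fun do rewrite dotp_delta.
    by apply/measurable_EFinP/measurable_funTS; exact: measurableT_comp.
  - by apply/measurable_EFinP/measurable_funTS.
  - move=> s _; rewrite dotp_delta lee_fin (le_trans (coord_le_enorm _ _))//.
    by rewrite lerDl sqr_ge0.
  - by move=> s _; rewrite lee_fin sqr_ge0.
  - under eq_fun do rewrite dotp_delta.
    by apply/measurable_EFinP/measurable_funTS; exact: measurable_funX.
  - by apply/measurable_EFinP/measurable_funTS.
  - move=> s _; rewrite dotp_delta lee_fin -[leLHS]add0r lerD ?enorm_ge0//.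
    rewrite -[leLHS]real_normK ?num_real// lerXn2r ?nnegrE ?enorm_ge0//.
    exact: coord_le_enorm.
under eq_integral do rewrite enorm_sqr -sumEFin.
rewrite ge0_integral_sum//.
- rewrite mulr_natl -[X in _ *+ X]card_ord -sumr_const -sumEFin.
  by apply: lee_sum => i _; exact: coordM.
- by move=> i; apply/measurable_EFinP; exact: measurable_funX.
- by move=> i x _; rewrite lee_fin sqr_ge0.
Qed.

End euclidean.

(** * Continuity and growth of the Stein operator *)

Lemma sequential_continuous (R : realType) m n (f : 'M[R]_(m, n) -> R) (p : 'M[R]_(m, n)) :
  (forall u : nat -> 'M[R]_(m, n), u k @[k --> \oo] --> p ->
     f (u k) @[k --> \oo] --> f p) ->
  {for p, continuous f}.
Proof.
move=> fseq A fpA; apply: contrapT => nf.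
have bad (k : nat) : {x | `|p - x| < k.+1%:R^-1 /\ ~ A (f x)}.
  apply: cid; apply: contrapT => nx; apply: nf.
  apply/nbhs_ballP; exists k.+1%:R^-1 => //= x; rewrite -ball_normE/= => px.
  by apply: contrapT => fx; apply: nx; exists x.
have up : (fun k => sval (bad k)) @ \oo --> p.
  apply/cvgrPdist_lt => r r0; exists (Num.truncn r^-1) => // k /= kr.
  apply: lt_trans (svalP (bad k)).1 _.
  rewrite -[ltRHS]invrK ltf_pV2 ?posrE ?invr_gt0//.
  by apply: lt_le_trans (truncnS_gt _) _; rewrite ler_nat.
have [N _ /(_ N (leqnn N))] := fseq _ up A fpA.
exact: (svalP (bad N)).2.
Qed.

(** In this section [f] is a bounded continuous field: dominated convergence,
with the dominating function d C |s|, integrable by the first moment of [nu],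
gives the continuity of [stein_op nu f], and the same domination its growth. *)

Section stein_operator.
Context {R : realType} {d : nat} (nu : {measure set 'rV[R]_d -> \bar R}).
Context (f : 'rV[R]_d -> 'rV[R]_d) (C : R).
Hypothesis f_cont : forall i, continuous (fun x => f x 0 i).
Hypothesis f_bnd : forall i x, `|f x 0 i| <= C.

Let dC_ge0 : 0 <= d%:R * C.
Proof.
case: (posnP d) => [d0|d0]; first by rewrite [X in X%:R]d0 mul0r.
by rewrite mulr_ge0//; apply: le_trans (f_bnd (Ordinal d0) 0).
Qed.

Let dotp_bnd s y : `|dotp s (f y)| <= d%:R * C * `|s|.
Proof.
apply: (le_trans (ler_norm_sum _ _ _)).
apply: (@le_trans _ _ (\sum_(i < d) C * `|s|)).
  apply: ler_sum => i _; rewrite normrM mulrC ler_pM//.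
  by apply: (rv_norm_le s (normr_ge0 s)).1.
by rewrite sumr_const card_ord -mulrA mulr_natl.
Qed.

(** The integrand of the outer integral in the Stein operator. *)
Definition stein_inner (x s : 'rV[R]_d) : R :=
  \int[Exp1]_e dotp s (f (x + e *: s)).

Let dotp_cvg (T : Type) (F : set_system T) {FF : Filter F} (u v : T -> 'rV[R]_d) x s :
  u t @[t --> F] --> x -> v t @[t --> F] --> s ->
  dotp (u t) (f (v t)) @[t --> F] --> dotp x (f s).
Proof.
move=> ux vs; apply: (@cvg_big _ _ _ _ _ _ _ F) => [|i _].
  exact: add_continuous.
apply: cvgM.
  by apply: (cvg_comp u (fun z : 'rV[R]_d => z 0 i) ux); exact: coord_continuous.
by apply: (cvg_comp v (fun z : 'rV[R]_d => f z 0 i) vs); exact: f_cont.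
Qed.

Let measurable_ray x s : measurable_fun setT (fun e : R => dotp s (f (x + e *: s))).
Proof.
apply: continuous_measurable_fun => e; apply: dotp_cvg; first exact: cvg_cst.
by apply: cvgD; [exact: cvg_cst|apply: cvgZr_tmp; exact: cvg_id].
Qed.

Let stein_inner_cvg (u v : nat -> 'rV[R]_d) x s :
  u k @[k --> \oo] --> x -> v k @[k --> \oo] --> s ->
  stein_inner (u k) (v k) @[k --> \oo] --> stein_inner x s.
Proof.
move=> ux vs.
have [B vB] : exists B, forall k, `|v k| <= B.
  have := cvg_seq_bounded (cvgP _ vs); rewrite /= => -[B [_ vB]].
  by exists (B + 1) => k; apply: (vB (B + 1)); rewrite ?ltrDl.
have intb y t : (@Exp1 R).-integrable setT (EFin \o (fun e => dotp t (f (y + e *: t)))).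
  apply: (@bounded_integrable _ (measurableTypeR R) _ _ _ (d%:R * C * `|t|)).
    exact: measurable_ray.
  by move=> e; exact: dotp_bnd.
apply: fine_cvg; rewrite fineK; last exact: integrable_fin_num (intb x s).
apply: (@dominated_cvg _ _ _ (@Exp1 R) setT measurableT _ _ (cst (d%:R * C * B)%:E)) => //.
- by move=> k; apply/measurable_EFinP; exact: measurable_ray.
- move=> e _; apply: cvg_EFin; first exact: nearW.
  apply: dotp_cvg => //; apply: cvgD => //.
  by apply: cvgZl_tmp.
- exact: (finite_measure_integrable_cst (@Exp1 R)).
- move=> k e _; rewrite lee_fin (le_trans (dotp_bnd _ _))//.
  exact: ler_wpM2l.
Qed.

(** Continuity in [s] replaces the measurability part of Fubini's theorem. *)
Let measurable_stein_inner x : measurable_fun setT (stein_inner x).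
Proof.
apply: continuous_measurable_mx => s; apply: sequential_continuous => v vs.
by apply: stein_inner_cvg => //; exact: cvg_cst.
Qed.

Let stein_inner_bnd x s : `|stein_inner x s| <= d%:R * C * enorm s.
Proof.
apply: (@Rintegral_abs_le _ _ _ (@Exp1 R) setT _ (cst (d%:R * C * enorm s))) => //.
- exact: measurable_ray.
- move=> e _; apply: (le_trans (dotp_bnd _ _)).
  by rewrite ler_wpM2l// norm_le_enorm.
- have -> := @integral_cst _ _ _ (@Exp1 R) setT measurableT (d%:R * C * enorm s)%:E.
  rewrite [X in (_ * X)%E](_ : _ = 1%E) ?mule1//.
  exact: (probability_setT (@Exp1 R)).
Qed.

Hypothesis nu_mean : (\int[nu]_(s in orthant) (enorm s)%:E < +oo)%E.

Let integrable_enorm : nu.-integrable orthant (EFin \o (fun s => d%:R * C * enorm s)).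
Proof.
have mO := @measurable_orthant R d.
rewrite (_ : EFin \o _ = (fun s => (d%:R * C)%:E * (enorm s)%:E)%E)//.
apply: integrableZl => //.
apply/integrableP; split.
  by apply/measurable_EFinP/measurable_funTS; exact: measurable_enorm.
by under eq_integral do rewrite gee0_abs ?lee_fin ?enorm_ge0//.
Qed.

Lemma continuous_stein_op : continuous (stein_op nu f).
Proof.
have mO := @measurable_orthant R d.
move=> x; apply: sequential_continuous => u ux.
apply: cvgB; first exact: dotp_cvg.
have ints y : nu.-integrable orthant (EFin \o stein_inner y).
  apply: le_integrable integrable_enorm => //.
    by apply/measurable_EFinP/measurable_funTS; exact: measurable_stein_inner.
  move=> s _; rewrite lee_fin (le_trans (stein_inner_bnd _ _))//.
  by rewrite ler_norm.
apply: fine_cvg; rewrite fineK; last exact: integrable_fin_num (ints x).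
apply: (@dominated_cvg _ _ _ nu orthant mO _ _ _ _ _ _ integrable_enorm) => //.
- by move=> k; apply/measurable_EFinP/measurable_funTS; exact: measurable_stein_inner.
- move=> s _; apply: cvg_EFin; first exact: nearW.
  by apply: stein_inner_cvg => //; exact: cvg_cst.
- by move=> k s _; rewrite lee_fin; exact: stein_inner_bnd.
Qed.

Lemma stein_op_growth : exists2 c, 0 <= c & forall x, `|stein_op nu f x| <= c * (1 + enorm x).
Proof.
have mO := @measurable_orthant R d.
pose m := fine (\int[nu]_(s in orthant) (d%:R * C * enorm s)%:E)%E.
have m0 : 0 <= m.
  by apply: fine_ge0; apply: integral_ge0 => s _; rewrite lee_fin mulr_ge0 ?enorm_ge0.
exists (d%:R * C + m) => [|x]; first exact: addr_ge0.
have h1 : `|dotp x (f x)| <= d%:R * C * enorm x.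
  by apply: (le_trans (dotp_bnd _ _)); rewrite ler_wpM2l// norm_le_enorm.
have h2 : `|\int[nu]_(s in orthant) stein_inner x s| <= m.
  apply: (@Rintegral_abs_le _ _ _ nu orthant _ (fun s => d%:R * C * enorm s)) => //.
  - by apply: measurable_funTS; exact: measurable_stein_inner.
  - by apply: measurable_funTS; apply: measurable_funM => //; exact: measurable_enorm.
  - by rewrite fineK//; exact: (integrable_fin_num _ integrable_enorm).
have e0 := enorm_ge0 x.
apply: (le_trans (ler_normB _ _)).
apply: (le_trans (lerD h1 h2)).
by move: dC_ge0 e0 m0; move: (d%:R * C) (enorm x) (m) => a b c *; nra.
Qed.

End stein_operator.

(** * Boundedness and continuity of the functions of the RKHS *)

Section rkhs.
Context {R : realType} {d : nat} {K : 'rV[R]_d -> 'rV[R]_d -> 'M[R]_d} (H : vvRKHS K).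
Implicit Types f g h : H.

Lemma rkhs_dot0 h : rkhs_dot 0 h = 0.
Proof.
have := rkhs_dot_linear 1 (0 : H) 0 h; rewrite scaler0 addr0 mul1r => e.
by move: e; move: (rkhs_dot _ _) => a; lra.
Qed.

Lemma rkhs_dotD f g h : rkhs_dot (f + g) h = rkhs_dot f h + rkhs_dot g h.
Proof. by rewrite -{1}[f]scale1r rkhs_dot_linear mul1r. Qed.

Lemma rkhs_dotZ a f h : rkhs_dot (a *: f) h = a * rkhs_dot f h.
Proof. by rewrite -[a *: f]addr0 rkhs_dot_linear rkhs_dot0 addr0. Qed.

Lemma rkhs_dotZr a f h : rkhs_dot h (a *: f) = a * rkhs_dot h f.
Proof. by rewrite rkhs_dotC rkhs_dotZ rkhs_dotC. Qed.

Lemma rkhs_dotDr f g h : rkhs_dot h (f + g) = rkhs_dot h f + rkhs_dot h g.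
Proof. by rewrite rkhs_dotC rkhs_dotD !(rkhs_dotC h). Qed.

(** With a = |g|^2 and b = <f,g>, the norm of a f - b g has the square
a (a |f|^2 - b^2). *)
Lemma rkhs_cauchy_schwarz f g : `|rkhs_dot f g| <= `|f| * `|g|.
Proof.
have [->|g0] := eqVneq g 0.
  by rewrite rkhs_dotC rkhs_dot0 !normr0 mulr0.
have a0 : 0 < `|g| ^+ 2 by rewrite exprn_gt0// normr_gt0.
set a := `|g| ^+ 2 in a0; set b := rkhs_dot f g.
have : 0 <= rkhs_dot (a *: f - b *: g) (a *: f - b *: g).
  by rewrite rkhs_norm sqr_ge0.
rewrite -scaleNr !(rkhs_dotD, rkhs_dotDr, rkhs_dotZ, rkhs_dotZr) !rkhs_norm.
rewrite (rkhs_dotC g f) -/a -/b => h.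
rewrite -(ler_pXn2r (n := 2))// ?nnegrE ?mulr_ge0//.
rewrite real_normK ?num_real// exprMn -/a -subr_ge0 -(pmulr_rge0 _ a0).
by apply: le_trans h _; rewrite le_eqVlt; apply/orP; left; apply/eqP; ring.
Qed.

Lemma rkhs_normB_sqr f g : `|f - g| ^+ 2 = `|f| ^+ 2 - 2 * rkhs_dot f g + `|g| ^+ 2.
Proof.
rewrite -scaleN1r -!rkhs_norm !(rkhs_dotD, rkhs_dotDr, rkhs_dotZ, rkhs_dotZr).
by rewrite (rkhs_dotC g f); ring.
Qed.

End rkhs.

Section scalar_rkhs.
Context {R : realType} {d : nat} (k : 'rV[R]_d -> 'rV[R]_d -> R).
Context (H : vvRKHS (fun x y => (k x y)%:M)).

(** The reproducing property along a vector of the canonical basis: evaluation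
of a coordinate is the scalar product with a section of the kernel. *)
Lemma rkhs_coord_eval (x : 'rV[R]_d) (i : 'I_d) : exists h : H,
  (forall f : H, rkhs_fun f x 0 i = rkhs_dot f h) /\
  (forall y, rkhs_fun h y 0 i = k y x).
Proof.
have [h hE fE] := rkhs_reproducing H x (delta_mx 0 i).
exists h; split => [f|y]; first by rewrite -fE dotp_delta.
rewrite hE /ksection tr_scalar_mx mul_mx_scalar mxE mxE.
by rewrite !eqxx mulr1.
Qed.

Lemma rkhs_coord_bounded (B : R) (f : H) i x : (forall x, k x x <= B ^+ 2) ->
  0 <= B -> `|rkhs_fun f x 0 i| <= `|f| * B.
Proof.
move=> kB B0; have [h [fE hE]] := rkhs_coord_eval x i.
rewrite fE (le_trans (rkhs_cauchy_schwarz _ _))// ler_wpM2l//.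
by rewrite -(ler_pXn2r (n := 2))// ?nnegrE// -rkhs_norm -fE hE.
Qed.

(** The difference of two values is the scalar product of [f] with the difference
of two sections, whose squared norm k(x,x) - 2 k(y,x) + k(y,y) tends to 0. *)
Lemma rkhs_coord_continuous (f : H) i : 
  continuous (fun p : 'rV[R]_d * 'rV[R]_d => k p.1 p.2) ->
  continuous (fun x => rkhs_fun f x 0 i).
Proof.
move=> kc x.
apply: sequential_continuous => u ux.
pose v n := Num.sqrt (k x x - 2 * k (u n) x + k (u n) (u n)).
have fv n : `|rkhs_fun f x 0 i - rkhs_fun f (u n) 0 i| <= `|f| * v n.
  have [hx [fx hxE]] := rkhs_coord_eval x i.
  have [hu [fu huE]] := rkhs_coord_eval (u n) i.
  have -> : rkhs_fun f x 0 i - rkhs_fun f (u n) 0 i = rkhs_dot f (hx - hu).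
    by rewrite -[- hu]scaleN1r rkhs_dotDr rkhs_dotZr fx fu; ring.
  rewrite (le_trans (rkhs_cauchy_schwarz _ _))// ler_wpM2l//.
  rewrite -[leLHS]ger0_norm// -sqrtr_sqr /v ler_wsqrtr// rkhs_normB_sqr -!rkhs_norm.
  by rewrite -fx -!fu !hxE huE.
have kcvg (a b : nat -> 'rV[R]_d) p q : a @ \oo --> p -> b @ \oo --> q ->
    k (a n) (b n) @[n --> \oo] --> k p q.
  move=> ap bq; apply: (@cvg_comp _ _ _
    (fun n => (a n, b n)) (fun z => k z.1 z.2) _ (nbhs (p, q))).
    exact: (cvg_pair ap bq).
  exact: (kc (p, q)).
have v0 : v n @[n --> \oo] --> 0.
  rewrite -[X in _ --> X](_ : Num.sqrt (k x x - 2 * k x x + k x x) = 0); last first.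
    by rewrite (_ : _ + _ = 0) ?sqrtr0//; ring.
  apply: (@cvg_comp _ _ _ (fun n => k x x - 2 * k (u n) x + k (u n) (u n)) Num.sqrt).
    apply: cvgD; last exact: (kcvg u u x x ux ux).
    apply: cvgB; [exact: cvg_cst|apply: cvgMl_tmp].
    by apply: (kcvg u (cst x) x x ux); exact: cvg_cst.
  exact: sqrt_continuous.
apply/cvgrPdist_le => e e0.
have fv0 : `|f| * v n @[n --> \oo] --> 0.
  by rewrite -[X in _ --> X](mulr0 `|f|); apply: cvgMl_tmp.
have [N _ NP] := (cvgrPdist_le _ _).1 fv0 e e0.
exists N => // n Nn /=; have := NP n Nn; rewrite /= sub0r normrN => h.
by apply: le_trans (fv n) _; apply: le_trans h; exact: ler_norm.
Qed.

End scalar_rkhs.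

(** * Weak convergence under bounded second moments *)

Section bounded_second_moment.
Context {R : realType} {d : nat}.
Implicit Types P : probability 'rV[R]_d R.

Let csqr : continuous (fun x : 'rV[R]_d => enorm x ^+ 2).
Proof.
move=> x; apply: (@continuous_comp _ _ _ enorm (fun r : R => r ^+ 2)).
  exact: continuous_enorm.
exact: exprn_continuous.
Qed.

Let msqr : measurable_fun setT (fun x : 'rV[R]_d => enorm x ^+ 2).
Proof. by apply: measurable_funX; exact: measurable_enorm. Qed.

(** Markov's inequality for the squared norm. *)
Lemma tight_of_second_moment (I : Type) (Q : I -> probability 'rV[R]_d R) (C : R) :
  (forall i, (\int[Q i]_x (enorm x ^+ 2)%:E <= C%:E)%E) ->
  forall e : R, 0 < e ->
  exists M : R, forall i, (Q i [set x | (M < `|x|)%R] <= e%:E)%E.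
Proof.
move=> QC e e0; pose M := `|C| / e + 1; exists M => i.
have M1 : 1 <= M by rewrite lerDr divr_ge0// ltW.
have M0 : 0 < M by lra.
have CM : C <= M ^+ 2 * e.
  apply: (@le_trans _ _ (M * e)).
    rewrite (le_trans (ler_norm C))// mulrDl mul1r divfK ?gt_eqF//; lra.
  by rewrite ler_pM2r// expr2 ler_peMl// ltW.
set B := [set x | _]; have mB : measurable B.
  apply: open_measurable_mx.
  apply: (@open_comp _ _ (fun x : 'rV[R]_d => `|x|) [set r | M < r]).
    by move=> z _; exact: norm_continuous.
  exact: open_gt.
have M20 : (0 < (M ^+ 2)%:E)%E by rewrite lte_fin exprn_gt0.
rewrite -(lee_pmul2l (_ : (M ^+ 2)%:E \is a fin_num) M20)//.
apply: (@le_trans _ _ (\int[Q i]_x (enorm x ^+ 2)%:E)%E); last first.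
  by rewrite -EFinM (le_trans (QC i))// lee_fin.
have <- : (\int[Q i]_(x in B) (M ^+ 2)%:E = (M ^+ 2)%:E * Q i B)%E.
  exact: integral_cst.
apply: (@le_trans _ _ (\int[Q i]_(x in B) (enorm x ^+ 2)%:E)%E).
  apply: ge0_le_integral => //.
  - by move=> x _; rewrite lee_fin sqr_ge0.
  - by apply/measurable_EFinP/measurable_funTS.
  - move=> x Bx; rewrite lee_fin lerXn2r ?nnegrE ?enorm_ge0 ?(ltW M0)//.
    by apply: ltW; apply: lt_le_trans Bx _; exact: norm_le_enorm.
apply: ge0_subset_integral => //.
  exact/measurable_EFinP.
by move=> x _; rewrite lee_fin sqr_ge0.
Qed.

(** The functions min(|x|^2, n), where |x| is the Euclidean norm, are bounded and
continuous, and increase to |x|^2. *)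
Lemma second_moment_limit (I : Type) (F : set_system I) {PF : ProperFilter F}
    (Q : I -> probability 'rV[R]_d R) P (C : R) :
  (forall i, (\int[Q i]_x (enorm x ^+ 2)%:E <= C%:E)%E) ->
  (forall g : 'rV[R]_d -> R, continuous g -> bounded_fun g ->
     \int[Q i]_x g x @[i --> F] --> \int[P]_x g x) ->
  (\int[P]_x (enorm x ^+ 2)%:E <= C%:E)%E.
Proof.
move=> QC QP.
pose g (n : nat) (x : 'rV[R]_d) := Num.min (enorm x ^+ 2) n%:R.
have g0 n x : 0 <= g n x by rewrite le_min sqr_ge0 ler0n.
have gn n x : g n x <= n%:R by rewrite ge_min lexx orbT.
have cg n : continuous (g n).
  move=> x; apply: (@continuous_min _ _ (fun x => enorm x ^+ 2) (cst n%:R)).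
    exact: csqr.
  exact: (@cst_continuous _ _ (n%:R : R)).
have ig n P' : P'.-integrable setT (EFin \o g n).
  apply: (bounded_integrable P' (M := n%:R)) => [|x].
    exact: continuous_measurable_mx.
  by rewrite ger0_norm.
have gC n : (\int[P]_x (g n x)%:E <= C%:E)%E.
  rewrite -[leLHS]fineK; last exact: integrable_fin_num (ig n P).
  rewrite lee_fin.
  apply: (closed_cvg (fun r : R => r <= C) (@closed_le R _) _ _ (QP (g n) _ _)).
  - apply: nearW => i; rewrite -lee_fin fineK; last exact: integrable_fin_num (ig n _).
    apply: le_trans (QC i); apply: ge0_le_integral => //.
    + by move=> x _; rewrite lee_fin.
    + by apply/measurable_EFinP; exact: continuous_measurable_mx.
    + exact/measurable_EFinP.
    + by move=> x _; rewrite lee_fin ge_min lexx.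
  - exact: cg.
  - exists n%:R; split; [exact: num_real|move=> N nN x _ /=].
    by rewrite ger0_norm// (le_trans (gn n x))// ltW.
pose D (n : nat) := [set x : 'rV[R]_d | enorm x ^+ 2 <= n%:R].
have mD n : measurable (D n).
  apply: closed_measurable_mx.
  apply: (@closed_comp _ _ (fun x : 'rV[R]_d => enorm x ^+ 2) [set r | r <= n%:R]).
    by move=> z _; exact: csqr.
  exact: closed_le.
have DT : \bigcup_n D n = setT.
  apply/seteqP; split => // x _; exists (Num.truncn (enorm x ^+ 2)).+1 => //=.
  by apply: ltW; exact: truncnS_gt.
have h : (\int[P]_(x in D n) (enorm x ^+ 2)%:E)%E @[n --> \oo] -->
    (\int[P]_x (enorm x ^+ 2)%:E)%E.
  rewrite -DT; apply: ge0_nondecreasing_set_cvg_integral => //.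
  - move=> n m nm; apply/subsetPset => x Dx; apply: (le_trans Dx).
    by rewrite ler_nat.
  - by move=> n; apply/measurable_EFinP/measurable_funTS.
  - by move=> n x _; rewrite lee_fin sqr_ge0.
rewrite -(cvg_lim _ h)//.
apply: lime_le; first by apply/cvg_ex; eexists; exact: h.
apply: nearW => n; apply: le_trans (gC n).
apply: (@le_trans _ _ (\int[P]_(x in D n) (g n x)%:E)%E).
  apply: ge0_le_integral => //.
  - by move=> x _; rewrite lee_fin sqr_ge0.
  - by apply/measurable_EFinP/measurable_funTS.
  - by apply/measurable_EFinP/measurable_funTS; exact: continuous_measurable_mx.
  - by move=> x Dx; rewrite lee_fin le_min lexx.
apply: ge0_subset_integral => //.
  by apply/measurable_EFinP; exact: continuous_measurable_mx.
by move=> x _; rewrite lee_fin.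
Qed.

Lemma integral_affine_le P (C a : R) : 0 <= a ->
  (\int[P]_x (enorm x ^+ 2)%:E <= C%:E)%E ->
  (\int[P]_x (a * (1 + enorm x ^+ 2))%:E <= (a * (1 + C))%:E)%E.
Proof.
move=> a0 PC; under eq_integral do rewrite EFinM.
have m1 : measurable_fun setT (fun x : 'rV[R]_d => 1 + enorm x ^+ 2).
  by apply: measurable_funD.
rewrite ge0_integralZl//.
- rewrite [leRHS]EFinM lee_wpmul2l ?lee_fin//.
  under eq_integral do rewrite EFinD.
  rewrite ge0_integralD//.
  + rewrite [leRHS]EFinD leeD// integral_cst// mul1e probability_le1//.
  + by move=> x _; rewrite lee_fin sqr_ge0.
  + by apply/measurable_EFinP; exact: msqr.
- exact/measurable_EFinP.
- by move=> x _; rewrite lee_fin addr_ge0// sqr_ge0.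
Qed.

Section linear_growth.
Context (h : 'rV[R]_d -> R) (c : R).
Hypothesis h_cont : continuous h.
Hypothesis h_growth : forall x, `|h x| <= c * (1 + enorm x).
Hypothesis c_ge0 : 0 <= c.

Let mh : measurable_fun setT h.
Proof. exact: continuous_measurable_mx. Qed.

Lemma integrable_linear_growth P (C : R) :
  (\int[P]_x (enorm x ^+ 2)%:E <= C%:E)%E -> P.-integrable setT (EFin \o h).
Proof.
move=> PC; apply/integrableP; split; first exact/measurable_EFinP.
have c20 : 0 <= 2 * c by rewrite mulr_ge0.
apply: le_lt_trans (le_lt_trans (integral_affine_le c20 PC) (ltry _)).
apply: ge0_le_integral => //.
- by apply/measurable_EFinP; exact: measurableT_comp.
- apply/measurable_EFinP; apply: measurable_funM => //.
  by apply: measurable_funD.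
- move=> x _; rewrite lee_fin (le_trans (h_growth x))//.
  rewrite [2 * c]mulrC -mulrA ler_wpM2l//.
  by have := enorm_ge0 x; move: (enorm x) => y *; nra.
Qed.

(** Truncation of [h] at the levels [-r] and [r]. *)
Let clip r x := Num.max (- r) (Num.min r (h x)).

Let clip_cont r : continuous (clip r).
Proof.
move=> x; apply: (@continuous_max _ _ (cst (- r)) (fun x => Num.min r (h x))).
  exact: (@cst_continuous _ _ (- r : R)).
apply: (@continuous_min _ _ (cst r) h); last exact: h_cont.
exact: (@cst_continuous _ _ (r : R)).
Qed.

Let clip_bnd r : 0 < r -> forall x, `|clip r x| <= r.
Proof.
move=> r0 x; rewrite ler_norml le_max lexx /= /clip ge_max ge_min lexx /= andbT.
by lra.
Qed.

(** Truncating [h] at level [r] changes it by at most h^2 / r, which has a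
quadratic growth. *)
Let clip_close P (C r : R) : 0 < r ->
  (\int[P]_x (enorm x ^+ 2)%:E <= C%:E)%E ->
  `|\int[P]_x h x - \int[P]_x clip r x| <= 2 * c ^+ 2 / r * (1 + C).
Proof.
move=> r0 PC.
have ih := integrable_linear_growth PC.
have mclip : measurable_fun setT (clip r) by apply: continuous_measurable_mx => x; exact: clip_cont.
have ic : P.-integrable setT (EFin \o clip r).
  exact: (bounded_integrable P mclip (clip_bnd r0)).
have a0 : 0 <= 2 * c ^+ 2 / r by rewrite divr_ge0 ?(ltW r0)// mulr_ge0// sqr_ge0.
rewrite -RintegralB//.
apply: (Rintegral_abs_le measurableT _ _ _ (integral_affine_le a0 PC)).
- exact: measurable_funB.
- by apply: measurable_funM => //; exact: measurable_funD.
move=> x _.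
have hr : `|h x - clip r x| <= h x ^+ 2 / r.
  rewrite ler_pdivlMr// /clip /Num.max /Num.min.
  have := sqr_ge0 (h x); rewrite expr2; move: (h x) => y y2.
  case: (ltP r y) => ry; case: ifPn => [|]; rewrite -?leNgt => hy.
  - by rewrite ger0_norm; nra.
  - by have := r0; lra.
  - by rewrite subrr normr0 mul0r.
  - by rewrite ler0_norm; nra.
apply: (le_trans hr); rewrite [leRHS]mulrAC ler_pM2r ?invr_gt0//.
have h2 : h x ^+ 2 <= (c * (1 + enorm x)) ^+ 2.
  rewrite -[leLHS]real_normK ?num_real// lerXn2r ?nnegrE//.
  by rewrite mulr_ge0// addr_ge0// enorm_ge0.
apply: (le_trans h2); rewrite exprMn.
have := sqr_ge0 c; have := sqr_ge0 (1 - enorm x); move: (enorm x) => y.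
by move: (c ^+ 2) => b; rewrite !expr2; nra.
Qed.

(** The truncation error is small uniformly in [i], by the second moments, and
the truncated function is bounded and continuous. *)
Lemma weak_cvg_linear_growth (I : Type) (F : set_system I) {PF : ProperFilter F}
    (Q : I -> probability 'rV[R]_d R) P (C : R) :
  (forall i, (\int[Q i]_x (enorm x ^+ 2)%:E <= C%:E)%E) ->
  (forall g : 'rV[R]_d -> R, continuous g -> bounded_fun g ->
     \int[Q i]_x g x @[i --> F] --> \int[P]_x g x) ->
  \int[Q i]_x h x @[i --> F] --> \int[P]_x h x.
Proof.
move=> QC QP.
have PC := second_moment_limit (PF := PF) QC QP.
have C0 : 0 <= C.
  by rewrite -lee_fin (le_trans _ PC)// integral_ge0// => x _; rewrite lee_fin sqr_ge0.
apply/cvgrPdist_le => e e0.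
have e30 : 0 < e / 3 by rewrite divr_gt0.
pose B := 2 * c ^+ 2 * (1 + C).
have B0 : 0 <= B by rewrite mulr_ge0 ?addr_ge0// mulr_ge0// sqr_ge0.
pose r := B / (e / 3) + 1.
have r0 : 0 < r by rewrite ltr_wpDl// divr_ge0// ltW.
have small : 2 * c ^+ 2 / r * (1 + C) <= e / 3.
  rewrite [leLHS]mulrAC ler_pdivrMr// -/B /r [leRHS]mulrDr mulr1.
  rewrite [X in _ <= X + _]mulrC divfK ?gt_eqF//.
  by rewrite lerDl ltW.
have hclip : F (fun i => `|\int[P]_x clip r x - \int[Q i]_x clip r x| <= e / 3).
  apply: ((cvgrPdist_le _ _).1 (QP (clip r) (@clip_cont r) _)) => //.
  exists r; split; [exact: num_real|move=> N rN x _ /=].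
  exact: le_trans (clip_bnd r0 x) (ltW rN).
apply: filterS hclip => i hi.
have h1 := le_trans (clip_close r0 PC) small.
have h2 := le_trans (clip_close r0 (QC i)) small.
move: h1 h2 hi; rewrite !ler_norml => /andP[? ?] /andP[? ?] /andP[? ?].
by apply/andP; split; lra.
Qed.

End linear_growth.
End bounded_second_moment.

(** * The convergence theorem *)

(** If some neighbourhood [B] of [l] were not reached, an ultrafilter finer than
[F] would contain the complement of the preimage of [B]. *)
Lemma cvg_of_ultra (I : Type) (T : topologicalType) (F : set_system I) (f : I -> T) (l : T) :
  ProperFilter F ->
  (forall U, UltraFilter U -> F `<=` U -> f @ U --> l) -> f @ F --> l.
Proof.
move=> PF Ul B Bl; apply: contrapT => nFB.
have PW : ProperFilter (within (~` (f @^-1` B)) F).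
  apply: Build_ProperFilter => W0; apply: nFB.
  suff : F (f @^-1` B) by [].
  have W1 : F [set i | ~ B (f i) -> False] := W0.
  by apply: filterS W1 => i ni; apply: contrapT => nB; exact: ni.
have [U [UU WU]] := ultraFilterLemma PW.
have PU := @ultra_proper _ U UU.
have UB : U (f @^-1` B).
  apply: (Ul U UU _ B Bl) => A FA; apply: WU.
  have : F [set i | ~ B (f i) -> A i] by apply: filterS FA => i Ai _.
  exact.
have UnB : U (~` (f @^-1` B)) by apply: WU; exact: (@filterE _ F).
by have [i [Bi]] := filter_ex (filterI UB UnB).
Qed.

Theorem theorem5p7 (R : realType) (d : nat) (d_ge1 : (1 <= d)%N)
    (nu : {measure set 'rV[R]_d -> \bar R}) (P : probability 'rV[R]_d R)
    (nu_thorin : thorin nu)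
    (nu_mean : (\int[nu]_(s in orthant) (enorm s)%:E < +oo)%E)
    (P_law : thorin_law nu P)
    (k : 'rV[R]_d -> 'rV[R]_d -> R)
    (k_kernel : scalar_kernel k)
    (k_bounded : bounded_fun (fun p : 'rV[R]_d * 'rV[R]_d => k p.1 p.2))
    (k_continuous : continuous (fun p : 'rV[R]_d * 'rV[R]_d => k p.1 p.2))
    (H : vvRKHS (fun x y => (k x y)%:M))
    (ksd_div : statistical_divergence nu P H)
    (nuN : nat -> {measure set 'rV[R]_d -> \bar R})
    (Q : nat -> probability 'rV[R]_d R)
    (nuN_thorin : forall N, thorin (nuN N))
    (Q_law : forall N, thorin_law (nuN N) (Q N))
    (nuN_moments : (ereal_sup [set \int[nuN N]_(s in orthant)
       (enorm s + enorm s ^+ 2)%:E | N in [set: nat]] < +oo)%E) :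
  (fun N => KSD nu H (Q N)) @ \oo --> 0%E -> weak_cvg Q P.
Proof.
move=> ksd0.
have [C QC] : exists C, forall N, (\int[Q N]_x (enorm x ^+ 2)%:E <= C%:E)%E.
  pose s := ereal_sup [set (\int[nuN N]_(s in orthant)
       (enorm s + enorm s ^+ 2)%:E)%E | N in [set: nat]].
  have sN N : (\int[nuN N]_(s in orthant) (enorm s + enorm s ^+ 2)%:E <= s)%E.
    by apply: ereal_sup_ubound; exists N.
  have s0 : (0 <= s)%E.
    apply: le_trans (sN 0%N); apply: integral_ge0 => x _.
    by rewrite lee_fin addr_ge0 ?enorm_ge0// sqr_ge0.
  exists (d%:R * (2 * (fine s + fine s ^+ 2))) => N.
  apply: (thorin_enorm_moment (Q_law N)).
  by rewrite fineK// ge0_fin_numE.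
(* Some B with k(x,x) <= B^2 for all x: then |f(x)_i| <= B |f|. *)
have [B B0 kB] : exists2 B : R, 0 <= B & forall x, k x x <= B ^+ 2.
  case: k_bounded => M [_ kM].
  exists (Num.max (M + 1) 1); first by rewrite le_max ler01 orbT.
  move=> x; have := kM (M + 1); rewrite ltrDl ltr01 => /(_ isT (x, x) I) /=.
  move=> h; apply: (le_trans (ler_norm _)); apply: (le_trans h).
  set m := Num.max _ _; have m1 : 1 <= m by rewrite le_max lexx orbT.
  apply: (@le_trans _ _ m); first by rewrite le_max lexx.
  by rewrite expr2 ler_peMl// (le_trans ler01).
have fcont (f : H) i : continuous (fun x => rkhs_fun f x 0 i).
  exact: rkhs_coord_continuous.
have fbnd (f : H) i x : `|rkhs_fun f x 0 i| <= `|f| * B.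
  exact: rkhs_coord_bounded.
have Tcont (f : H) : continuous (stein_op nu (rkhs_fun f)).
  exact: (continuous_stein_op (fcont f) (fbnd f) nu_mean).
have Tgrowth (f : H) : exists2 c, 0 <= c &
    forall x, `|stein_op nu (rkhs_fun f) x| <= c * (1 + enorm x).
  exact: (stein_op_growth (fcont f) (fbnd f) nu_mean).
have Tint (f : H) (Q' : probability 'rV[R]_d R) : (\int[Q']_x (enorm x ^+ 2)%:E <= C%:E)%E ->
    Q'.-integrable setT (EFin \o stein_op nu (rkhs_fun f)).
  have [c c0 cb] := Tgrowth f.
  exact: (integrable_linear_growth (Tcont f) cb c0).
have Tto0 (f : H) : `|f| <= 1 -> (\int[Q N]_x stein_op nu (rkhs_fun f) x) @[N --> \oo] --> 0.
  move=> f1; apply/cvgrPdist_le => e e0.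
  have [K0 K0f] := (fine_cvgP _ _).1 ksd0.
  have hN N : (`|\int[Q N]_y (stein_op nu (rkhs_fun f) y)%:E| <= KSD nu H (Q N))%E.
    by apply: ereal_sup_ubound; exists f.
  have [N1 _ N1P] := K0.
  have [N2 _ N2P] := (cvgrPdist_le _ _).1 K0f e e0.
  exists (maxn N1 N2) => // N /=; rewrite geq_max => /andP[/N1P kfin /N2P].
  rewrite /= !sub0r !normrN => kse; apply: le_trans kse.
  apply: le_trans (ler_norm _).
  rewrite -lee_fin fineK// EFin_normr_Rintegral//.
    exact: hN.
  exact: (Tint f _ (QC N)).
move=> g cg bg; apply: cvg_of_ultra => U UU ooU.
have PU := @ultra_proper _ U UU.
have [Pl Plg] := tight_ultra_limit UU (tight_of_second_moment QC).
have PlC := second_moment_limit (PF := PU) QC Plg.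
have zero (f : H) : `|f| <= 1 -> (\int[Pl]_y (stein_op nu (rkhs_fun f) y)%:E = 0)%E.
  move=> f1; rewrite -[LHS]fineK; last exact: integrable_fin_num (Tint f Pl PlC).
  congr EFin.
  have [c c0 cb] := Tgrowth f.
  have h := weak_cvg_linear_growth (PF := PU) (Tcont f) cb c0 QC Plg.
  apply: (cvg_unique (@Rhausdorff R) h).
  by move=> A A0; apply: ooU; exact: (Tto0 f f1 A A0).
have ksdl : KSD nu H Pl = 0%E.
  rewrite /KSD (_ : [set _ | _ in _] = [set 0%E]) ?ereal_sup1//.
  apply/seteqP; split => [_ [f /= f1 <-]|_ ->]; first by rewrite zero// abse0.
  by exists 0; rewrite /= ?normr0 ?ler01// zero ?normr0// abse0.
have PlP := (ksd_div Pl (fun f => Tint f Pl PlC)).1 ksdl.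
have <- : \int[Pl]_x g x = \int[P]_x g x.
  by congr fine; apply: eq_measure_integral => A mA _; exact: PlP.
exact: Plg.
Qed.
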